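(* Let $2<p\le4$ and let $(f_i)_{i=1}^\infty\subseteq L_p(\mathbb{R})$ be an unconditional basis for a closed subspace $X\subseteq L_p(\mathbb{R})$, where all $f_i$ are translates of some fixed $f\in L_p(\mathbb{R})$. Then $X$ embeds isomorphically into $\ell_p$.
   Context: The translate of $f$ by $\lambda$ is $f_{(\lambda)}(x)=f(x-\lambda)$. $X$ embeds isomorphically into $\ell_p$ if there is a bounded linear injection $T:X\to\ell_p$ with bounded inverse on its range. *)

(* Defs.v *)
From HB Require Import structures.
From mathcomp Require Import all_boot all_order all_algebra.
From mathcomp Require Import all_classical all_reals all_analysis.
Set Implicit Arguments. Unset Strict Implicit. Unset Printing Implicit Defensive.
Import Order.TTheory GRing.Theory Num.Theory.
Import numFieldNormedType.Exports.
Local Open Scope classical_set_scope.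
Local Open Scope ring_scope.

Section Defs.
Context {R : realType}.

Definition translate (f : R -> R) (lam : R) : R -> R := fun x => f (x - lam).

Definition Lp_fun (p : R) (f : R -> R) : Prop :=
  measurable_fun setT f /\ finite_norm (@lebesgue_measure R) p%:E f.

(** the L_p(R) norm (real-valued; meaningful for L_p functions) *)
Definition Lp_norm (p : R) (f : R -> R) : R :=
  fine ('N[@lebesgue_measure R]_p%:E [EFin \o f])%E.

Definition lp_seq (p : R) (a : nat -> R) : Prop :=
  finite_norm (@counting nat R) p%:E a.

Definition lp_norm (p : R) (a : nat -> R) : R :=
  fine ('N[@counting nat R]_p%:E [EFin \o a])%E.

Definition Lp_conv (p : R) (u : nat -> R -> R) (x : R -> R) : Prop :=
  (fun n => Lp_norm p (fun t => u n t - x t)) @ \oo --> (0 : R).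

Definition closed_subspace (p : R) (X : set (R -> R)) : Prop :=
  [/\ X `<=` Lp_fun p,
      X (fun _ => 0),
      (forall (a b : R) (x y : R -> R), X x -> X y ->
         X (fun t => a * x t + b * y t)) &
      (forall (u : nat -> R -> R) (x : R -> R),
         (forall n, X (u n)) -> Lp_fun p x -> Lp_conv p u x -> X x)].

Definition psum (a : nat -> R) (b : nat -> R -> R) (s : nat -> nat)
  : nat -> R -> R :=
  fun n t => \sum_(i < n) a (s i) * b (s i) t.

Definition unconditional_basis (p : R) (b : nat -> R -> R) (X : set (R -> R))
  : Prop :=
  (forall i, X (b i)) /\
  (forall x, X x ->
     (exists! a : nat -> R, Lp_conv p (psum a b id) x) /\
     (forall a : nat -> R, Lp_conv p (psum a b id) x ->
        forall s : nat -> nat, bijective s -> Lp_conv p (psum a b s) x)).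

Definition embeds_into_lp (p : R) (X : set (R -> R)) : Prop :=
  exists T : (R -> R) -> (nat -> R),
    [/\ (forall (a b : R) (x y : R -> R), X x -> X y ->
           T (fun t => a * x t + b * y t) = (fun k => a * T x k + b * T y k)),
        (forall x, X x -> lp_seq p (T x)) &
        exists c C : R, [/\ 0 < c, 0 < C &
          forall x, X x ->
            c * Lp_norm p x <= lp_norm p (T x) /\
            lp_norm p (T x) <= C * Lp_norm p x]].

End Defs.

(* Main.v *)
Require Import Defs.
From HB Require Import structures.
From mathcomp Require Import all_boot all_order all_algebra.
From mathcomp Require Import all_classical all_reals all_analysis.
From mathcomp Require Import measurable_realfun ring lra.
Import Order.TTheory GRing.Theory Num.Theory.
Import numFieldNormedType.Exports.
Set Implicit Arguments. Unset Strict Implicit. Unset Printing Implicit Defensive.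
Local Open Scope classical_set_scope.
Local Open Scope ring_scope.

(** Let b_i be the translates of f by lambda_i. A Baire category argument gives
    C with ||sum_{i<n} e_i a_i b_i|| <= C ||x|| for all signs e_i, where
    x = sum a_i b_i; hence ||x||^p is equivalent to the supremum over n of
    A_n = E_e ||sum_{i<n} e_i a_i b_i||^p. Translation is continuous in L_p, so
    the lambda_i are separated, by eta > 0 say, and the translates of f restrict
    to an interval J of length eta with sum_i int_J |b_i|^p <= ||f||^p, since the
    sets J - lambda_i are disjoint. Now, pointwise, E_e |sum e_i c_i|^p is at
    least sum |c_i|^p (as p >= 2), and for c_i = a_i y_i it is at most
    4 (sum |a_i|^p) (sum |y_i|^p) (as p <= 4). Therefore replacing the b_i by
    functions h_i with sum_i ||b_i - h_i||^p small changes A_n by at most a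
    constant factor, and the h_i can be chosen constant on the pieces of a countable
    partition, with only finitely many of them nonzero on each piece. The p-th
    root of the average with h_i in place of b_i is then literally an l_p norm
    of a sequence depending linearly on x: its entries are the signed sums on
    each piece, for each of the finitely many choices of signs. *)

(** * Unconditional bases have a uniform unconditional constant *)

(** The hypothesis only says that expansions are unique and that every rearrangement of one still
    converges to the same function; a bound uniform in the signs, in [n] and in [x] has to be
    extracted from it. The averaging answers an obstacle in the discretization. On a cell J the
    integrals of |b_i|^p are summable over i, but no rate is known. A triangle inequality estimate
    of the error would ask for control of sum |a_i| ||b_i - h_i||, whereas the a_i and the norms
    ||b_i - h_i|| are only known to be p-summable. For sign averages the error is governed by the
    square function, and (sum a_i^2 y_i^2)^(1/2) <= ||a||_4 ||y||_4, so that p-summability of both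
    factors suffices when p <= 4. The two pointwise inequalities meet in S = sum |a_i|^p. As all b_i
    have the norm of f, the lower one gives S ||f||^p <= A_n, while the upper one bounds the average
    of the error by a small multiple of S. The error is thus absorbed into A_n itself. *)

Lemma leq_id_homo (m : nat -> nat) :
  (forall j, (m j < m j.+1)%N) -> forall j, (j <= m j)%N.
Proof. by move=> mS; elim=> // j /leq_ltn_trans; apply. Qed.

(** * Rearrangements that bring chosen indices to the front of each block *)

Section BlockPermutation.
Variables (m : nat -> nat) (F : nat -> pred nat).
Hypotheses (m0 : m 0%N = 0%N) (mS : forall j, (m j < m j.+1)%N).

Let blk j := index_iota (m j) (m j.+1).

(** In each block the indices selected by [F] precede the others, so that an arbitrary selection
    becomes a contiguous segment of a single rearrangement of all indices. *)
Fixpoint block_list (j : nat) : seq nat :=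
  if j is j'.+1 then
    block_list j' ++ ([seq i <- blk j' | F j' i] ++ [seq i <- blk j' | ~~ F j' i])
  else [::].

Lemma perm_block_list j : perm_eq (block_list j) (iota 0 (m j)).
Proof.
elim: j => [|j IH] /=; first by rewrite m0.
have -> : iota 0 (m j.+1) = iota 0 (m j) ++ blk j.
  by rewrite /blk /index_iota -{1}(subnKC (ltnW (mS j))) iotaD.
by apply: perm_cat => //; rewrite perm_filterC.
Qed.

Lemma size_block_list j : size (block_list j) = m j.
Proof. by rewrite (perm_size (perm_block_list j)) size_iota. Qed.

Lemma block_list_nth j k i : (j <= k)%N -> (i < m j)%N ->
  nth 0%N (block_list k) i = nth 0%N (block_list j) i.
Proof.
move=> /subnKC <-; elim: (k - j)%N => [|d IH] ij; first by rewrite addn0.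
rewrite addnS /= nth_cat size_block_list.
have -> : (i < m (j + d))%N.
  apply: leq_trans ij _; elim: d {IH} => [|d IH]; first by rewrite addn0.
  by rewrite addnS; apply: leq_trans IH (ltnW (mS _)).
exact: IH.
Qed.

(** The list has length [m i.+1], which exceeds [i], so the default value is never read; longer
    lists have the same entry at [i]. *)
Definition block_perm (i : nat) : nat := nth 0%N (block_list i.+1) i.

Lemma block_permE j i : (i < m j)%N -> block_perm i = nth 0%N (block_list j) i.
Proof.
move=> ij; have im : (i < m i.+1)%N by exact: leq_id_homo.
rewrite /block_perm; case: (leqP j i.+1) => [ji|/ltnW ji].
  exact: block_list_nth.
by rewrite -(block_list_nth ji).
Qed.

Lemma block_perm_bij : bijective block_perm.
Proof.
have inj : injective block_perm.
  move=> i i' eq; pose j := (maxn i i').+1.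
  have mj : (j <= m j)%N by exact: leq_id_homo.
  have ij : (i < m j)%N by apply: leq_trans mj; rewrite ltnS leq_maxl.
  have ij' : (i' < m j)%N by apply: leq_trans mj; rewrite ltnS leq_maxr.
  move: eq; rewrite (block_permE ij) (block_permE ij') => /eqP.
  rewrite nth_uniq ?size_block_list//; first by move=> /eqP.
  by rewrite (perm_uniq (perm_block_list j)) iota_uniq.
have surj k : exists i, block_perm i = k.
  have mk : (k < m k.+1)%N by exact: leq_id_homo.
  have kin : k \in block_list k.+1.
    by rewrite (perm_mem (perm_block_list _)) mem_iota.
  exists (index k (block_list k.+1)).
  by rewrite (@block_permE k.+1) ?nth_index// -size_block_list index_mem.
pose g k := projT1 (cid (surj k)).
have gK : cancel g block_perm by move=> k; rewrite /g; case: cid.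
by exists g => // i; apply: inj; rewrite gK.
Qed.

Lemma sum_block_perm (V : zmodType) (g : nat -> V) j k :
  (k <= m j)%N -> \sum_(i < k) g (block_perm i) = \sum_(i <- take k (block_list j)) g i.
Proof.
move=> kj; rewrite (big_nth 0%N) big_mkord size_take size_block_list.
have -> : (if (k < m j)%N then k else m j) = k.
  by case: ltngtP kj.
apply: eq_bigr => i _; rewrite nth_take// -block_permE//.
exact: leq_trans (ltn_ord i) kj.
Qed.

(** This is the use of the rearrangement: a sum over any selection from a block is a difference of
    two of its partial sums, so convergence of the rearranged series makes it small. *)
Lemma block_perm_segment j : exists k : nat, (m j <= k)%N /\
  forall (V : zmodType) (g : nat -> V),
  \sum_(i < k) g (block_perm i) - \sum_(i < m j) g (block_perm i) =
  \sum_(m j <= i < m j.+1 | F j i) g i.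
Proof.
set s := [seq i <- blk j | F j i].
exists (m j + size s)%N; split; first exact: leq_addr.
move=> V g; rewrite (@sum_block_perm _ _ j.+1) ?(@sum_block_perm _ _ j)//; last first.
  rewrite -(subnKC (ltnW (mS j))) leq_add2l.
  by rewrite (leq_trans (size_subseq (filter_subseq _ _)))// size_iota.
rewrite [take (m j) (block_list j)]take_oversize ?size_block_list//=.
rewrite take_cat size_block_list ltnNge leq_addr /= addKn.
by rewrite take_size_cat// big_cat /= addrAC subrr add0r big_filter.
Qed.

End BlockPermutation.

Lemma geometric_limit (R : realType) (d : nat -> R) (D : R) :
  (forall k, `|d k| <= D * 2^-1 ^+ k) ->
  exists l : R, forall n, `|l - \sum_(k < n) d k| <= 2 * D * 2^-1 ^+ n.
Proof.
move=> dD.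
have D0 : 0 <= D by have := dD 0%N; rewrite expr0 mulr1; exact: le_trans.
(* Keeping the subtracted tail on the right makes the bound telescope, which closes the induction on
   [j]. *)
have seg n j : `|\sum_(k < n + j) d k - \sum_(k < n) d k|
    <= 2 * D * 2^-1 ^+ n - 2 * D * 2^-1 ^+ (n + j).
  elim: j => [|j IH]; first by rewrite addn0 !subrr normr0.
  rewrite addnS big_ord_recr /= -addrA addrCA addrC.
  apply: le_trans (ler_normD _ _) _.
  have := dD (n + j)%N; rewrite exprS; move: IH; set u := `|_|; lra.
have pw n : 0 <= 2 * D * 2^-1 ^+ n :> R.
  by rewrite !mulr_ge0// exprn_ge0// invr_ge0.
have cv : cvgn (series d).
  apply: normed_cvg; apply: (@series_le_cvg _ _ (geometric D 2^-1)) => //.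
  - by move=> n /=.
  - by move=> n /=; rewrite mulr_ge0// exprn_ge0// invr_ge0.
  - by apply: is_cvg_geometric_series; rewrite ger0_norm ?invr_ge0// invf_lt1// ltr1n.
exists (limn (series d)) => n.
have cvn : `|series d k - \sum_(k < n) d k| @[k --> \oo] -->
    `|limn (series d) - \sum_(k < n) d k|.
  by apply: cvg_norm; apply: cvgB => //; exact: cvg_cst.
rewrite -(cvg_lim (@Rhausdorff R) cvn); apply: limr_le; first exact/cvgP/cvn.
near=> k; have nk : (n <= k)%N by near: k; exact: nbhs_infty_ge.
rewrite /series /= big_mkord -(subnKC nk); apply: le_trans (seg _ _) _.
by rewrite gerBl.
Unshelve. all: by end_near. Qed.

(** * A Baire category argument in a complete seminormed space *)

Section UnconditionalConstant.
Variables (R : realType) (V : lmodType R) (X : set V) (N : V -> R) (b : nat -> V).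
Hypotheses
  (X0 : X 0) (Xlin : forall (c : R) x y, X x -> X y -> X (c *: x + y))
  (N0 : forall x, X x -> 0 <= N x)
  (NZ : forall (c : R) x, X x -> N (c *: x) = `|c| * N x)
  (ND : forall x y, X x -> X y -> N (x + y) <= N x + N y)
  (Xb : forall i, X (b i)).

(** [N] is only a seminorm, since functions equal almost everywhere are not identified; convergence
    is therefore expressed through [N] and limits are not unique. *)
Definition seminorm_cvg (u : nat -> V) (x : V) : Prop :=
  forall eta : R, 0 < eta -> exists n0, forall n, (n0 <= n)%N -> N (u n - x) <= eta.

Definition expansion (a : nat -> R) (n : nat) : V := \sum_(i < n) a i *: b i.

Definition signed_expansion (e : nat -> bool) (a : nat -> R) (n : nat) : V :=
  \sum_(i < n) ((-1) ^+ e i * a i) *: b i.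

Hypotheses
  (complete : forall u : nat -> V, (forall n, X (u n)) ->
     (forall n, N (u n.+1 - u n) <= 4^-1 ^+ n) ->
     exists2 x, X x & seminorm_cvg u x)
  (exists_expansion : forall x, X x -> exists a, seminorm_cvg (expansion a) x)
  (unique_expansion : forall x a a', X x -> seminorm_cvg (expansion a) x ->
     seminorm_cvg (expansion a') x -> forall i, a i = a' i)
  (permuted_expansion : forall x a (s : nat -> nat), X x -> seminorm_cvg (expansion a) x ->
     bijective s -> seminorm_cvg (fun n => \sum_(i < n) a (s i) *: b (s i)) x).

Let XD x y : X x -> X y -> X (x + y).
Proof. by move=> Xx Xy; rewrite -[x]scale1r; exact: Xlin. Qed.

Let XZ c x : X x -> X (c *: x).
Proof. by move=> Xx; rewrite -[_ *: _]addr0; exact: Xlin. Qed.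

Let XN x : X x -> X (- x).
Proof. by move=> Xx; rewrite -scaleN1r; exact: XZ. Qed.

Let XB x y : X x -> X y -> X (x - y).
Proof. by move=> Xx Xy; apply: XD => //; exact: XN. Qed.

Let Xsum (I : Type) (r : seq I) (P : pred I) (F : I -> V) :
  (forall i, X (F i)) -> X (\sum_(i <- r | P i) F i).
Proof. by move=> XF; elim/big_ind: _ => // *; exact: XD. Qed.

Let Nzero : N 0 = 0.
Proof. by rewrite -(scale0r (0 : V)) NZ// normr0 mul0r. Qed.

Let NN x : X x -> N (- x) = N x.
Proof. by move=> Xx; rewrite -scaleN1r NZ// normrN1 mul1r. Qed.

Let NB x y : X x -> X y -> N (x - y) <= N x + N y.
Proof. by move=> Xx Xy; rewrite -(NN Xy) ND//; exact: XN. Qed.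

Let Nsum (I : Type) (r : seq I) (P : pred I) (F : I -> V) :
  (forall i, X (F i)) -> N (\sum_(i <- r | P i) F i) <= \sum_(i <- r | P i) N (F i).
Proof.
move=> XF.
suff : X (\sum_(i <- r | P i) F i) /\
    N (\sum_(i <- r | P i) F i) <= \sum_(i <- r | P i) N (F i) by case.
elim/big_ind2: _ => [|x1 x2 y1 y2 [Xx xle] [Xy yle]|i _]; first by rewrite Nzero.
  by split; [exact: XD|apply: le_trans (ND Xx Xy) _; exact: lerD].
by split.
Qed.

Let XabE (a : nat -> R) i : X (a i *: b i). Proof. exact: XZ. Qed.

Let Xexp a n : X (expansion a n). Proof. by apply: Xsum => i; exact: XZ. Qed.
Let Xsexp e a n : X (signed_expansion e a n).
Proof. by apply: Xsum => i; exact: XZ. Qed.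

Let sexpD e a a' n :
  signed_expansion e (fun i => a i + a' i) n =
  signed_expansion e a n + signed_expansion e a' n.
Proof.
by rewrite /signed_expansion -big_split; apply: eq_bigr => i _; rewrite /= mulrDr scalerDl.
Qed.

Let sexpZ e c a n :
  signed_expansion e (fun i => c * a i) n = c *: signed_expansion e a n.
Proof.
by rewrite /signed_expansion scaler_sumr; apply: eq_bigr => i _; rewrite scalerA mulrCA.
Qed.

Let expE a n : expansion a n = signed_expansion (fun=> false) a n.
Proof. by apply: eq_bigr => i _; rewrite expr0 mul1r. Qed.

Let expD a a' n :
  expansion (fun i => a i + a' i) n = expansion a n + expansion a' n.
Proof. by rewrite !expE sexpD. Qed.

Let expZ c a n : expansion (fun i => c * a i) n = c *: expansion a n.
Proof. by rewrite !expE sexpZ. Qed.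

Let cvgD_exp a a' x y : X x -> X y ->
  seminorm_cvg (expansion a) x -> seminorm_cvg (expansion a') y ->
  seminorm_cvg (expansion (fun i => a i + a' i)) (x + y).
Proof.
move=> Xx Xy ax ay eta eta0; have e2 : 0 < eta / 2 by rewrite divr_gt0.
have [n1 h1] := ax _ e2; have [n2 h2] := ay _ e2.
exists (maxn n1 n2) => n; rewrite geq_max => /andP[l1 l2].
rewrite expD opprD addrACA [eta]splitr.
apply: le_trans (ND _ _) (lerD (h1 _ l1) (h2 _ l2)); exact: XB.
Qed.

Let cvgZ_exp c a x : X x ->
  seminorm_cvg (expansion a) x -> seminorm_cvg (expansion (fun i => c * a i)) (c *: x).
Proof.
move=> Xx ax eta eta0.
have [|n0 h] := ax (eta / (`|c| + 1)); first by rewrite divr_gt0// ltr_wpDl.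
exists n0 => n /h hn; rewrite expZ -scalerBr NZ; last exact: XB.
rewrite ler_pdivlMr ?ltr_wpDl// in hn.
by apply: le_trans hn; rewrite mulrC ler_wpM2l ?lerDl//; apply: N0; exact: XB.
Qed.

(** If [N (b i)] vanished, both the zero sequence and the indicator of [i] would be coefficients of
    0, against uniqueness. *)
Lemma basis_gt0 i : 0 < N (b i).
Proof.
rewrite lt_neqAle N0// andbT; apply/eqP => Nbi.
have c0 : seminorm_cvg (expansion (fun=> 0)) 0.
  move=> eta eta0; exists 0%N => n _; rewrite /expansion big1 ?subr0 ?Nzero ?ltW//.
  by move=> j _; rewrite scale0r.
have c1 : seminorm_cvg (expansion (fun j => (j == i)%:R)) 0.
  move=> eta eta0; exists 0%N => n _; rewrite subr0; apply: le_trans (ltW eta0).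
  apply: le_trans (Nsum _ _ _) _ => [j|]; first exact: XZ.
  rewrite big1// => j _; rewrite NZ//.
  by have [->|] := eqVneq (j : nat) i; rewrite ?normr0 ?mul0r -?Nbi ?mulr0.
by have /(_ i)/eqP := unique_expansion X0 c0 c1; rewrite eqxx eq_sym oner_eq0.
Qed.

(** Otherwise beyond every index there is a finite selection whose sum exceeds [eta]. Consecutive
    blocks carrying such selections, rearranged with the selection in front, yield a rearranged
    series whose partial sums are not Cauchy. *)
Let finite_sums_small x a : X x -> seminorm_cvg (expansion a) x ->
  forall eta, 0 < eta -> exists n0, forall n1 (F : pred nat),
  N (\sum_(n0 <= i < n1 | F i) a i *: b i) <= eta.
Proof.
move=> Xx ax eta eta0; apply: contrapT => /forallNP H.
have {}H n0 : exists q : nat * pred nat,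
    eta < N (\sum_(n0 <= i < q.1 | q.2 i) a i *: b i).
  have /existsNP[n1 /existsNP[F /negP]] := H n0.
  by rewrite -ltNge => h; exists (n1, F).
have [q hq] := choice H.
pose m := fix m j := if j is j'.+1 then (q (m j')).1 else 0%N.
(* A block that did not advance would carry an empty sum, whose seminorm 0 is not above [eta]. *)
have mS j : (m j < m j.+1)%N.
  rewrite ltnNge; apply/negP => le; have := hq (m j).
  by rewrite [(q _).1]/(m j.+1) big_geq// Nzero ltNge (ltW eta0).
have [n0 hn0] := permuted_expansion Xx ax (@block_perm_bij _ (fun j => (q (m j)).2) erefl mS)
  (divr_gt0 eta0 (ltr0n R 2)).
have [k [mk hk]] := @block_perm_segment _ (fun j => (q (m j)).2) erefl mS n0.
have n0m := leq_id_homo mS n0.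
have := hq (m n0); rewrite ltNge => /negP; apply.
rewrite -[(q _).1]/(m n0.+1) -(hk _ (fun i => a i *: b i)).
set s1 := \sum_(i < k) _; set s2 := \sum_(i < _) _.
have -> : s1 - s2 = (s1 - x) - (s2 - x) by rewrite opprB addrA subrK.
have Xs n : X (\sum_(i < n) a (block_perm m (fun j => (q (m j)).2) i) *:
   b (block_perm m (fun j => (q (m j)).2) i)) by apply: Xsum => i; exact: XZ.
rewrite [eta]splitr; apply: le_trans (NB _ _) (lerD (hn0 _ _) (hn0 _ _)) => //.
- by apply: XB => //; exact: Xs.
- by apply: XB => //; exact: Xs.
- exact: leq_trans mk.
Qed.

Definition sign_bounded (M : R) (x : V) : Prop := exists a,
  seminorm_cvg (expansion a) x /\ forall n e, N (signed_expansion e a n) <= M.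

(** Beyond [n0] a signed sum is the sum over the positive signs minus the sum over the negative
    ones, each of seminorm at most 1; the first [n0] terms are bounded by [S]. So [X] is covered by
    the countably many sets to which Baire's argument applies. *)
Let sign_bounded_nat x : X x -> exists M : nat, sign_bounded M%:R x.
Proof.
move=> Xx; have [a ax] := exists_expansion Xx.
have [n0 hn0] := finite_sums_small Xx ax ltr01.
pose S := \sum_(i < n0) `|a i| * N (b i).
have S0 : 0 <= S by apply: sumr_ge0 => i _; rewrite mulr_ge0 ?N0.
have Nsgn (e : bool) i : N (((-1) ^+ e * a i) *: b i) = `|a i| * N (b i).
  by rewrite NZ// normrM normrX normrN1 expr1n mul1r.
suff H n e : N (signed_expansion e a n) <= S + 2.
  exists (Num.truncn (S + 2)).+1, a; split=> // n e.
  by apply: le_trans (H n e) _; rewrite ltW// truncnS_gt.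
have [nn0|/ltnW n0n] := leqP n n0.
  apply: (@le_trans _ _ S); last by rewrite lerDl.
  apply: le_trans (Nsum _ _ _) _ => [i|]; first exact: XZ.
  rewrite (eq_bigr (fun i : 'I_n => `|a i| * N (b i))); last by move=> i _; exact: Nsgn.
  rewrite /S -(big_mkord xpredT (fun i => `|a i| * N (b i))).
  rewrite -(big_mkord xpredT (fun i => `|a i| * N (b i))).
  rewrite (big_cat_nat (n := n) (p := n0))//= lerDl sumr_ge0// => i _.
  by rewrite mulr_ge0 ?N0.
have -> : signed_expansion e a n = signed_expansion e a n0 +
    (\sum_(n0 <= i < n | ~~ e i) a i *: b i - \sum_(n0 <= i < n | e i) a i *: b i).
  rewrite /signed_expansion -(big_mkord xpredT (fun i => ((-1) ^+ e i * a i) *: b i)).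
  rewrite (big_cat_nat (n := n0))//= big_mkord; congr (_ + _).
  rewrite (bigID e) /= addrC; congr (_ + _).
    by apply: eq_bigr => i /negbTE ->; rewrite mul1r.
  by rewrite -sumrN; apply: eq_bigr => i ->; rewrite expr1 mulN1r scaleNr.
apply: le_trans (ND _ _) (lerD _ _) => //; first by apply: XB; exact: Xsum.
  apply: le_trans (Nsum _ _ _) _ => [i|]; first exact: XZ.
  by rewrite /S ler_sum// => i _; rewrite Nsgn.
by apply: le_trans (NB _ _) (lerD (hn0 _ _) (hn0 _ _)); exact: Xsum.
Qed.

Let sign_boundedD M M' x y : X x -> X y ->
  sign_bounded M x -> sign_bounded M' y -> sign_bounded (M + M') (x + y).
Proof.
move=> Xx Xy [a [ax aM]] [a' [ay aM']]; exists (fun i => a i + a' i); split.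
  exact: cvgD_exp.
by move=> n e; rewrite sexpD; apply: le_trans (ND _ _) (lerD (aM _ _) (aM' _ _)).
Qed.

Let sign_boundedZ c M x : X x -> sign_bounded M x -> sign_bounded (`|c| * M) (c *: x).
Proof.
move=> Xx [a [ax aM]]; exists (fun i => c * a i); split; first exact: cvgZ_exp.
by move=> n e; rewrite sexpZ NZ// ler_wpM2l.
Qed.

Let expansion_norm a n (B : R) : (forall i, `|a i| * N (b i) <= B) ->
  forall e, N (signed_expansion e a n) <= n%:R * B.
Proof.
move=> aB e; apply: le_trans (Nsum _ _ _) _ => [i|]; first exact: XZ.
apply: (@le_trans _ _ (\sum_(i < n) B)); last first.
  by rewrite sumr_const card_ord mulr_natl.
by apply: ler_sum => i _; rewrite NZ// normrM normrX normrN1 expr1n mul1r.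
Qed.

Let coefficient_le a M : (forall n e, N (signed_expansion e a n) <= M) ->
  forall i, `|a i| * N (b i) <= 2 * M.
Proof.
move=> aM i; rewrite -NZ//.
have -> : a i *: b i = signed_expansion (fun=> false) a i.+1
    - signed_expansion (fun=> false) a i.
  by rewrite /signed_expansion big_ord_recr /= mul1r addrAC subrr add0r.
by apply: le_trans (NB _ _) _ => //; rewrite mulr2n mulrDl mul1r; apply: lerD.
Qed.

(** Baire's theorem by hand: if no level were dense in any ball, nested balls avoiding the levels
    one after the other would shrink to a point of [X] that belongs to none. *)
Let sign_bounded_somewhere_dense : exists (M : nat) (x0 : V) (r : R),
  [/\ X x0, 0 < r & forall y, X y -> N (y - x0) <= r -> forall eta, 0 < eta ->
    exists z, [/\ X z, sign_bounded M%:R z & N (y - z) <= eta]].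
Proof.
apply: contrapT => H.
(* Stage [q.1] avoids the level of the same number. The factors 1/4 for the radius and 1/2 for the
   shift of the center keep the balls nested and the centers rapidly Cauchy. *)
have step (q : nat * (V * R)) : exists q' : V * R, X q.2.1 -> 0 < q.2.2 ->
    [/\ X q'.1, 0 < q'.2, q'.2 <= q.2.2 / 4, N (q'.1 - q.2.1) <= q.2.2 / 2 &
     forall z, X z -> sign_bounded q.1%:R z -> q'.2 < N (q'.1 - z)].
  case: q => M [x r] /=; have [r0|r0] := ltP 0 r; last first.
    by exists (x, r) => _; rewrite ltNge r0.
  have [Xx|nXx] := pselect (X x); last by exists (x, r).
  have : ~ (forall y, X y -> N (y - x) <= r / 2 -> forall eta, 0 < eta ->
      exists z, [/\ X z, sign_bounded M%:R z & N (y - z) <= eta]).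
    by move=> h; apply: H; exists M, x, (r / 2); split=> //; rewrite divr_gt0.
  move=> /existsNP[y /not_implyP[Xy /not_implyP[yx /existsNP[eta
    /not_implyP[eta0 /forallNP hz]]]]].
  exists (y, Num.min eta (r / 4)) => _ _ /=; split=> //.
  - by rewrite lt_min eta0 divr_gt0.
  - by rewrite ge_min lexx orbT.
  - move=> z Xz Mz; rewrite gt_min; apply/orP; left; rewrite ltNge.
    by apply/negP => le; apply: (hz z).
have [g hg] := choice step.
pose u := fix u n := if n is n'.+1 then g (n', u n') else (0, 1) : V * R.
have uP n : X (u n).1 /\ 0 < (u n).2.
  by elim: n => [//|n [Xu ru]]; have [] := hg (n, u n) Xu ru.
have uS n := hg (n, u n) (uP n).1 (uP n).2.
have rle n : (u n).2 <= 4^-1 ^+ n.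
  elim: n => [//|n IH]; have [_ _ h _ _] := uS n.
  by apply: le_trans h _; rewrite exprSr /= ler_pM2r// invr_gt0.
have [x Xx ux] : exists2 x, X x & seminorm_cvg (fun n => (u n).1) x.
  apply: complete => n; first exact: (uP n).1.
  have [_ _ _ h _] := uS n; apply: le_trans h _ => /=.
  by have := rle n; have := (uP n).2; lra.
have [M Mx] := sign_bounded_nat Xx.
have near_x n j : N ((u (n + j)%N).1 - (u n).1) + (u (n + j)%N).2 <= (u n).2.
  elim: j => [|j IH]; first by rewrite addn0 subrr Nzero add0r.
  rewrite addnS; have [/= _ _ h1 h2 _] := uS (n + j)%N.
  have -> : (u (n + j).+1).1 - (u n).1 =
    ((u (n + j).+1).1 - (u (n + j)%N).1) + ((u (n + j)%N).1 - (u n).1).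
    by rewrite addrA subrK.
  have := ND (XB (uP (n + j).+1).1 (uP (n + j)%N).1) (XB (uP (n + j)%N).1 (uP n).1).
  have := (uP (n + j)%N).2; rewrite /= in h1 h2 *; lra.
(* The limit [x] has some level [M], yet it lies in the ball of stage [M.+1], which stays away from
   that level. *)
have [_ _ _ _ /(_ x Xx Mx)] := uS M.
rewrite ltNge => /negP; apply; rewrite -[g _]/(u M.+1).
apply/ler_addgt0Pr => e e0; have [n1 hn1] := ux e e0.
have -> : (u M.+1).1 - x =
    ((u (M.+1 + n1)%N).1 - x) - ((u (M.+1 + n1)%N).1 - (u M.+1).1).
  by rewrite opprB [RHS]addrC addrA subrK.
apply: le_trans (NB _ _) _; [exact: XB (uP _).1 _|exact: XB (uP _).1 (uP _).1|].
rewrite addrC; apply: lerD; last by apply: hn1; rewrite leq_addl.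
by apply: le_trans (near_x M.+1 n1); rewrite lerDl ltW// (uP _).2.
Qed.

(** Density near [x0] moves to the origin by differences: scale [y] to the radius [r], approximate
    both its translate by [x0] and [x0] itself, and subtract. The levels add up to [2 * M], and
    scaling back by [t / r] gives the constant. *)
Let sign_bounded_dense : exists2 K : R, 0 <= K & forall y t eta, X y -> 0 < t ->
  N y <= t -> 0 < eta -> exists z, [/\ X z, sign_bounded (K * t) z & N (y - z) <= eta].
Proof.
have [M [x0 [r [Xx0 r0 H]]]] := sign_bounded_somewhere_dense.
exists (2 * M%:R / r); first by rewrite divr_ge0// ?mulr_ge0// ltW.
move=> y t eta Xy t0 yt eta0.
have d0 : 0 < eta * r / t / 2 by rewrite !divr_gt0// mulr_gt0.
have rt0 : 0 < r / t by rewrite divr_gt0.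
have Xy' : X ((r / t) *: y) by exact: XZ.
have [|z1 [Xz1 Mz1 h1]] := H ((r / t) *: y + x0) (XD Xy' Xx0) _ _ d0.
  by rewrite addrK NZ// gtr0_norm// mulrAC ler_pdivrMr// ler_pM2l.
have [|z2 [Xz2 Mz2 h2]] := H x0 Xx0 _ _ d0; first by rewrite subrr Nzero ltW.
exists ((t / r) *: (z1 - z2)); split; first by apply: XZ; exact: XB.
  have -> : 2 * M%:R / r * t = `|t / r| * (M%:R + `|-1| * M%:R).
    by rewrite normrN1 gtr0_norm ?divr_gt0//; ring.
  apply: sign_boundedZ; first exact: XB.
  rewrite -scaleN1r; apply: sign_boundedD => //; first exact: XZ.
  exact: sign_boundedZ.
have -> : y - (t / r) *: (z1 - z2) =
    (t / r) *: (((r / t) *: y + x0 - z1) - (x0 - z2)).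
  rewrite [X in _ = _ *: X](_ : _ = (r / t) *: y - (z1 - z2)); last first.
    rewrite !opprB [_ + x0 - z1]addrAC [z2 - x0]addrC addrA addrK.
    by rewrite [RHS]addrA [RHS]addrAC.
  rewrite [in RHS]scalerBr scalerA mulrA divfK ?gt_eqF// divff ?gt_eqF// scale1r.
  by [].
rewrite NZ; last by apply: XB; [apply: XB => //; exact: XD|exact: XB].
rewrite gtr0_norm ?divr_gt0// mulrC -ler_pdivlMr ?divr_gt0//.
apply: le_trans (NB _ _) _; [apply: XB => //; exact: XD|exact: XB|].
apply: le_trans (lerD h1 h2) _; rewrite -splitr invf_div mulrA//.
Qed.

(** Approximation is upgraded to membership as in the open mapping theorem: approximate [y], then
    the remainder at half the scale, and so on. The pieces [z n] have levels [K * t / 2 ^ n], whose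
    sum is twice the first, and their coefficients add up to coefficients of [y]. *)
Let sign_bounded_ball : exists2 K : R, 0 <= K & forall y t, X y -> 0 < t -> N y <= t ->
  sign_bounded (K * t) y.
Proof.
have [K K0 HK] := sign_bounded_dense.
exists (2 * K); first by rewrite mulr_ge0.
move=> y t Xy t0 yt.
have step (q : nat * V) : exists z, X q.2 -> N q.2 <= t * 2^-1 ^+ q.1 ->
    [/\ X z, sign_bounded (K * t * 2^-1 ^+ q.1) z & N (q.2 - z) <= t * 2^-1 ^+ q.1.+1].
  case: q => n x /=; have [Xx|] := pselect (X x); last by exists 0.
  have [le|nle] := leP (N x) (t * 2^-1 ^+ n); last by exists 0.
  have tn k : 0 < t * 2^-1 ^+ k by rewrite mulr_gt0// exprn_gt0// invr_gt0.
  have [z zP] := HK x _ _ Xx (tn n) le (tn n.+1); exists z => _ _.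
  by rewrite -mulrA.
have [g hg] := choice step.
pose w := fix w n := if n is n'.+1 then w n' - g (n', w n') else y.
pose z n := g (n, w n).
have wP n : X (w n) /\ N (w n) <= t * 2^-1 ^+ n.
  elim: n => [|n [Xw wle]]; first by rewrite expr0 mulr1.
  by have [Xg _ h] := hg (n, w n) Xw wle; split=> //; exact: XB.
have zP n := hg (n, w n) (wP n).1 (wP n).2.
have sum_z n : w n = y - \sum_(k < n) z k.
  elim: n => [|n IH]; first by rewrite big_ord0 subr0.
  by rewrite big_ord_recr /= opprD addrA -IH.
have /choice[al hal] n : exists a, seminorm_cvg (expansion a) (z n) /\
    forall m e, N (signed_expansion e a m) <= K * t * 2^-1 ^+ n.
  by have [_ [a h] _] := zP n; exists a.
pose D := K * t; have D0 : 0 <= D by rewrite mulr_ge0// ltW.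
(* Each single coefficient of [z k] is at most [2 * D / 2 ^ k] divided by [N (b i)], so the
   coefficients can be summed one by one. *)
have /choice[a ha] i : exists l : R, forall n,
    `|l - \sum_(k < n) al k i| <= 2 * (2 * D / N (b i)) * 2^-1 ^+ n.
  apply: (@geometric_limit R (fun k => al k i)) => k; have Ni := basis_gt0 i.
  rewrite mulrAC ler_pdivlMr// -mulrA; exact: coefficient_le (hal k).2 i.
pose c n i := \sum_(k < n) al k i.
have sexpB e (a1 a2 : nat -> R) n : signed_expansion e (fun i => a1 i - a2 i) n =
    signed_expansion e a1 n - signed_expansion e a2 n.
  rewrite -scaleN1r -sexpZ -sexpD; congr signed_expansion.
  by apply/funext => i; rewrite mulN1r.
have sexpc e n m : signed_expansion e (c n) m = \sum_(k < n) signed_expansion e (al k) m.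
  elim: n => [|n IH]; rewrite ?big_ord0 ?big_ord_recr /= -?IH -?sexpD.
    by rewrite /signed_expansion big1// => i _; rewrite /c big_ord0 mulr0 scale0r.
  by congr signed_expansion; apply/funext => i; rewrite /c big_ord_recr.
have tail n j e m : N (signed_expansion e (fun i => c (n + j)%N i - c n i) m)
    <= 2 * D * 2^-1 ^+ n - 2 * D * 2^-1 ^+ (n + j).
  rewrite sexpB; elim: j => [|j IH]; first by rewrite addn0 !subrr Nzero.
  rewrite addnS sexpc big_ord_recr /= -sexpc addrAC.
  apply: le_trans (ND (XB _ _) _) _ => //.
  by have := (hal (n + j)%N).2 m e; rewrite exprS -/D; move: IH; lra.
(* The bound has to be uniform in [m] and [e]. For fixed [m] the finitely many coefficients of [c k]
   tend to those of [a], so the uniform bound [tail] for [c k - c n] survives the limit in [k]. *)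
have ctail n e m : N (signed_expansion e (fun i => a i - c n i) m) <= 2 * D * 2^-1 ^+ n.
  have small k : N (signed_expansion e (fun i => a i - c k i) m) <=
      m%:R * (4 * D) * 2^-1 ^+ k.
    rewrite -mulrA; apply: expansion_norm => i.
    have := ha i k; rewrite -/(c k i) => h.
    apply: le_trans (ler_wpM2r (ltW (basis_gt0 i)) h) _.
    rewrite le_eqVlt; apply/orP; left; apply/eqP; field.
    by rewrite gt_eqF// basis_gt0.
  have cv : (2 * D * 2^-1 ^+ n + m%:R * (4 * D) * 2^-1 ^+ k) @[k --> \oo] -->
      2 * D * 2^-1 ^+ n + 0.
    apply: cvgD; first exact: cvg_cst.
    by apply: cvg_geometric; rewrite ger0_norm ?invr_ge0// invf_lt1// ltr1n.
  rewrite -[leRHS]addr0 -(cvg_lim (@Rhausdorff R) cv); apply: limr_ge; first exact/cvgP/cv.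
  near=> k; have nk : (n <= k)%N by near: k; exact: nbhs_infty_ge.
  have -> : (fun i => a i - c n i) = (fun i => (a i - c k i) + (c k i - c n i)).
    by apply/funext => i; rewrite addrA subrK.
  rewrite sexpD [leRHS]addrC; apply: le_trans (ND _ _) (lerD (small k) _) => //.
  rewrite -(subnKC nk); apply: le_trans (tail _ _ _ _) _.
  by rewrite gerBl; apply: mulr_ge0; [exact: mulr_ge0|rewrite exprn_ge0// invr_ge0].
exists a; split; last first.
  move=> n e; have := ctail 0%N e n; rewrite expr0 mulr1 /D mulrA.
  by congr (N _ <= _); congr signed_expansion; apply/funext => i; rewrite /c big_ord0 subr0.
have part n : seminorm_cvg (expansion (c n)) (\sum_(k < n) z k).
  elim: n => [|n IH].
    move=> eta eta0; exists 0%N => m _; rewrite big_ord0 subr0 /expansion big1 ?Nzero ?ltW//.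
    by move=> i _; rewrite /c big_ord0 scale0r.
  rewrite big_ord_recr /=.
  have -> : c n.+1 = (fun i => c n i + al n i) by apply/funext => i; rewrite /c big_ord_recr.
  have [Xz _ _] := zP n.
  by apply: cvgD_exp => //; [apply: Xsum => k; have [] := zP k|exact: (hal n).1].
move=> eta eta0.
(* [2 * D] accounts for the coefficients added after stage [k] and [t] for the remainder [w k]; the
   other half of [eta] goes to the expansion of the first [k] pieces. *)
have cv : ((t + 2 * D) * 2^-1 ^+ k) @[k --> \oo] --> 0.
  by apply: cvg_geometric; rewrite ger0_norm ?invr_ge0// invf_lt1// ltr1n.
have [k hk] : exists k, (t + 2 * D) * 2^-1 ^+ k <= eta / 2.
  have /cvgrPdist_le/(_ (eta / 2))[|n _ /(_ n (leqnn n))] := cv; first by rewrite divr_gt0.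
  by rewrite sub0r normrN => h; exists n; apply: le_trans h; rewrite ler_norm.
have [n0 hn0] := part k _ (divr_gt0 eta0 (ltr0n R 2)).
exists n0 => n /hn0 hn.
have -> : expansion a n - y =
    signed_expansion (fun=> false) (fun i => a i - c k i) n +
    ((expansion (c k) n - \sum_(k < k) z k) - w k).
  by rewrite sexpB -!expE sum_z opprB [X in _ = _ + X]addrA subrK addrA subrK.
have [Xw wle] := wP k.
have Xz : X (\sum_(k < k) z k) by apply: Xsum => j; have [] := zP j.
apply: le_trans (ND _ _) _ => //; first by apply: XB => //; exact: XB.
apply: le_trans (lerD (ctail _ _ _) (NB _ _)) _ => //; first exact: XB.
by move: hn wle hk; lra.
Unshelve. all: by end_near. Qed.

Theorem unconditional_constant : exists2 C : R, 0 < C & forall x a n e, X x ->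
  seminorm_cvg (expansion a) x -> N (signed_expansion e a n) <= C * N x.
Proof.
have [K K0 HK] := sign_bounded_ball.
exists (K + 1) => [|x a n e Xx ax]; first by rewrite ltr_wpDl.
apply/ler_addgt0Pr => eps eps0.
have d0 : 0 < eps / (K + 1) by rewrite divr_gt0// ltr_wpDl.
(* The radius must be positive while [N x] may be 0; the slack costs at most [eps] in the final
   bound. *)
have t0 : 0 < N x + eps / (K + 1) by rewrite ltr_wpDl// N0.
have Nt : N x <= N x + eps / (K + 1) by rewrite lerDl ltW.
have [a' [ax' h]] := HK _ _ Xx t0 Nt.
have -> : a = a' by apply/funext => i; exact: unique_expansion ax ax' i.
apply: le_trans (h n e) _.
have -> : (K + 1) * N x + eps = (K + 1) * (N x + eps / (K + 1)).
  by field; rewrite gt_eqF// ltr_wpDl.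
rewrite ler_wpM2r ?lerDl//; by rewrite addr_ge0 ?N0// ltW.
Qed.

End UnconditionalConstant.

(** * Averages over signs *)

Section PowerInequalities.
Context {R : realType}.
Implicit Types (a b x y p q : R).

Lemma powR_le p x y : 0 <= p -> 0 <= x -> x <= y -> x `^ p <= y `^ p.
Proof.
by move=> p0 x0 xy; apply: ge0_ler_powR; rewrite // nnegrE// (le_trans x0).
Qed.

Lemma powRK p x : p != 0 -> 0 <= x -> (x `^ p) `^ p^-1 = x.
Proof. by move=> p0 x0; rewrite -powRrM mulfV// powRr1. Qed.

Lemma powRVK p x : p != 0 -> 0 <= x -> (x `^ p^-1) `^ p = x.
Proof. by move=> p0 x0; rewrite -powRrM mulVf// powRr1. Qed.

(** A ratio in [0, 1] dominates its [q]-th power; apply this to the two shares [a / (a + b)] and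
    [b / (a + b)], whose sum is 1. *)
Lemma powRD_super q a b : 1 <= q -> 0 <= a -> 0 <= b ->
  a `^ q + b `^ q <= (a + b) `^ q.
Proof.
move=> q1 a0 b0; have q0 : 0 < q by rewrite (lt_le_trans ltr01).
have [/eqP|s0] := eqVneq (a + b) 0.
  rewrite paddr_eq0// => /andP[/eqP -> /eqP ->].
  by rewrite addr0 powR0 ?gt_eqF// addr0.
have {}s0 : 0 < a + b by rewrite lt_neqAle eq_sym s0 addr_ge0.
have le c : 0 <= c -> c <= a + b -> c `^ q <= c / (a + b) * (a + b) `^ q.
  move=> c0 cs; have [->|cn0] := eqVneq c 0; first by rewrite powR0 ?gt_eqF// !mul0r.
  rewrite -[in leLHS](divfK (lt0r_neq0 s0) c) powRM ?divr_ge0 ?(ltW s0)//.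
  rewrite ler_wpM2r ?powR_ge0// ge1r_powR// ler_pdivrMr// mul1r cs andbT.
  by rewrite divr_gt0// lt_neqAle eq_sym cn0.
apply: le_trans (lerD (le a a0 _) (le b b0 _)) _; rewrite ?lerDl ?lerDr//.
by rewrite -mulrDl -mulrDl divff ?gt_eqF// mul1r.
Qed.

Lemma powR_midpoint q x y : 1 <= q -> 0 <= x -> 0 <= y ->
  ((x + y) / 2) `^ q <= (x `^ q + y `^ q) / 2.
Proof.
move=> q1 x0 y0; have h0 : 0 <= 2^-1 :> R by lra.
have h1 : 2^-1 <= 1 :> R by lra.
have := @convex_powR R q q1 (Itv01 h0 h1) x y.
rewrite !inE /= !in_itv /= !andbT => /(_ x0 y0); have half : 1 - 2^-1 = 2^-1 :> R by lra.
rewrite convRE /= /unstable.onem half.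
have -> : (x + y) / 2 = 2^-1 * x + 2^-1 * y by ring.
have -> : (x `^ q + y `^ q) / 2 = 2^-1 * x `^ q + 2^-1 * y `^ q by ring.
rewrite [X in X `^ q <= _ -> _](_ : _ = 2^-1 * x + (1 - 2^-1) * y)//.
by rewrite half.
Qed.

Lemma powR_sqr_norm p x : `|x| `^ p = (x ^+ 2) `^ (p / 2).
Proof.
by rewrite -[x ^+ 2]ger0_norm ?sqr_ge0// normrX -powR_mulrn// -powRrM mulrC divfK.
Qed.

(** With exponent [p / 2] on squares, superadditivity followed by convexity reduces the claim to the
    parallelogram identity. *)
Lemma powR_parallelogram p x y : 2 <= p ->
  `|x| `^ p + `|y| `^ p <= (`|x + y| `^ p + `|x - y| `^ p) / 2.
Proof.
move=> p2; have q1 : 1 <= p / 2 by rewrite ler_pdivlMr// mul1r.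
rewrite !powR_sqr_norm; apply: le_trans (powRD_super q1 (sqr_ge0 _) (sqr_ge0 _)) _.
apply: le_trans (powR_midpoint q1 (sqr_ge0 _) (sqr_ge0 _)).
by rewrite (_ : x ^+ 2 + y ^+ 2 = ((x + y) ^+ 2 + (x - y) ^+ 2) / 2)//; field.
Qed.

Lemma powR_normD p x y : 0 <= p ->
  `|x + y| `^ p <= 2 `^ p * (`|x| `^ p + `|y| `^ p).
Proof.
move=> p0; wlog xy : x y / `|x| <= `|y|.
  move=> h; have [/h//|/ltW/h] := leP `|x| `|y|.
  by rewrite addrC [X in _ * X]addrC.
apply: (@le_trans _ _ ((2 * `|y|) `^ p)).
  apply: powR_le => //; apply: le_trans (ler_normD _ _) _.
  by rewrite mulr_natl mulr2n lerD2r.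
by rewrite powRM// ler_wpM2l ?powR_ge0// lerDr powR_ge0.
Qed.

(** The signed power sign(x) |x|^p, Mazur's map from L_p to L_1. *)
Definition mazur p x : R := x * `|x| `^ (p - 1).

Lemma norm_mazur p x : 0 < p -> `|mazur p x| = `|x| `^ p.
Proof.
by move=> p0; rewrite normrM [X in _ * X]ger0_norm ?powR_ge0// mulr_powRB1.
Qed.

(** For equal signs this is superadditivity of the power, without the factor; for opposite signs the
    right-hand difference is [|x| ^ p + |y| ^ p] and the factor pays for the sum inside the
    power. *)
Lemma mazur_dist p x y : 1 <= p ->
  `|x - y| `^ p <= 2 `^ p * `|mazur p x - mazur p y|.
Proof.
move=> p1; have p0 : 0 < p by rewrite (lt_le_trans ltr01).
have mN z : mazur p (- z) = - mazur p z by rewrite /mazur normrN mulNr.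
have mp z : 0 <= z -> mazur p z = z `^ p by move=> z0; rewrite /mazur ger0_norm// mulr_powRB1.
have c1 : 1 <= 2 `^ p by apply: le_trans (le1r_powR _ p1); rewrite ler1n.
wlog yx : x y / `|y| <= `|x|.
  by move=> h; have [/h//|/ltW/h] := leP `|y| `|x|; rewrite distrC (distrC (mazur _ _)).
wlog x0 : x y yx / 0 <= x.
  move=> h; have [/h|x0] := leP 0 x; first exact.
  have := h (- x) (- y); rewrite !normrN => /(_ yx); rewrite !mN -!opprD !normrN.
  by apply; rewrite oppr_ge0 ltW.
have [y0|y0] := leP 0 y.
  move: yx; rewrite (ger0_norm x0) (ger0_norm y0) => yx.
  rewrite !mp// !ger0_norm ?subr_ge0//; last first.
    by apply: powR_le => //; exact: ltW.
  apply: (@le_trans _ _ (x `^ p - y `^ p)); last first.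
    by rewrite ler_peMl// subr_ge0; apply: powR_le => //; exact: ltW.
  by rewrite lerBrDr; apply: le_trans (powRD_super p1 _ y0) _; rewrite ?subr_ge0// subrK.
have Ny0 : 0 <= - y by rewrite oppr_ge0 ltW.
have -> : mazur p x - mazur p y = `|x| `^ p + `|- y| `^ p.
  by rewrite -mN !mp// (ger0_norm x0) (ger0_norm Ny0).
rewrite [X in _ <= _ * X]ger0_norm ?addr_ge0 ?powR_ge0//.
by apply: powR_normD; exact: ltW.
Qed.

Lemma powR_le1D4 p x : 0 <= p -> p <= 4 -> `|x| `^ p <= 1 + x ^+ 4.
Proof.
move=> p0 p4; have x4 : 0 <= x ^+ 4 by rewrite exprn_even_ge0.
have [x1|/ltW x1] := leP `|x| 1.
  by have := powR_le p0 (normr_ge0 x) x1; rewrite powR1 => /le_trans; apply; rewrite lerDl.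
apply: (@le_trans _ _ (`|x| `^ 4)); first by rewrite ler_powR.
by rewrite -[4]/(4%:R) powR_mulrn// -normrX ger0_norm// lerDr.
Qed.

Lemma expr4_le_powR p x : 0 < p -> p <= 4 -> `|x| `^ p <= 1 -> x ^+ 4 <= `|x| `^ p.
Proof.
move=> p0 p4 xp1.
have x1 : `|x| <= 1.
  rewrite -(powRK (lt0r_neq0 p0) (normr_ge0 x)).
  have pV0 : 0 <= p^-1 by rewrite invr_ge0 ltW.
  by have := powR_le pV0 (powR_ge0 _ _) xp1; rewrite powR1.
have -> : x ^+ 4 = `|x| `^ 4.
  by rewrite -[4 in RHS]/(4%:R) powR_mulrn// -normrX ger0_norm// exprn_even_ge0.
have [->|xn0] := eqVneq x 0; first by rewrite normr0 !powR0 ?gt_eqF.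
by apply: ger_powR => //; rewrite normr_gt0 xn0.
Qed.

End PowerInequalities.

(** * Moments of signed sums *)

Section SignAverages.
Context {R : realType}.
Implicit Types (phi psi : R -> R) (c d : nat -> R).

(** The j-th choice of signs reads off the binary digits of j < 2 ^ n. *)
Definition sign_sum (n : nat) (c : nat -> R) (j : nat) : R :=
  \sum_(i < n) (-1) ^+ odd (j %/ 2 ^ i) * c i.

Definition sign_avg (n : nat) (phi : R -> R) (c : nat -> R) : R :=
  2^-1 ^+ n * \sum_(j < 2 ^ n) phi (sign_sum n c j).

Lemma sign_avg0 phi c : sign_avg 0 phi c = phi 0.
Proof. by rewrite /sign_avg expr0 mul1r expn0 big_ord1 /sign_sum big_ord0. Qed.

(** Averaging over the last sign: the indices below [2 ^ n.+1] split by bit [n] into [j] and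
    [2 ^ n + j], which share all lower bits. *)
Lemma sign_avgS n phi c :
  sign_avg n.+1 phi c = sign_avg n (fun s => (phi (s + c n) + phi (s - c n)) / 2) c.
Proof.
have high_bit i j : (i < n)%N -> odd ((2 ^ n + j) %/ 2 ^ i) = odd (j %/ 2 ^ i).
  move=> ni; rewrite -(subnKC ni) addSnnS expnD mulnC divnMDl ?expn_gt0//.
  by rewrite oddD expnS oddM.
rewrite /sign_avg exprSr -mulrA; congr (_ * _).
rewrite -mulr_suml mulrC; congr (_ / 2).
rewrite expnS mul2n -addnn big_split_ord /= -big_split /=.
apply: eq_bigr => j _; rewrite /sign_sum; congr (phi _ + phi _); rewrite big_ord_recr /=.
  by rewrite divn_small// mul1r.
rewrite divnDl// divnn expn_gt0 /= (divn_small (ltn_ord j)) addn0 expr1 mulN1r.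
congr (_ - _); apply: eq_bigr => i _; congr ((-1) ^+ _ * _).
by rewrite high_bit.
Qed.

Lemma sign_avg_stable n m phi c : (forall i, (n <= i)%N -> c i = 0) -> (n <= m)%N ->
  sign_avg m phi c = sign_avg n phi c.
Proof.
move=> c0 /subnKC <-; elim: (m - n)%N => [|k IH]; first by rewrite addn0.
rewrite addnS sign_avgS -IH c0 ?leq_addr//; congr sign_avg; apply/funext => s.
by rewrite addr0 subr0; field.
Qed.

Lemma ler_sign_avg n phi psi c :
  (forall s, phi s <= psi s) -> sign_avg n phi c <= sign_avg n psi c.
Proof.
move=> le; rewrite ler_wpM2l ?exprn_ge0 ?invr_ge0//; exact: ler_sum.
Qed.

Lemma sign_avgD n phi psi c :
  sign_avg n (fun s => phi s + psi s) c = sign_avg n phi c + sign_avg n psi c.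
Proof. by rewrite /sign_avg big_split mulrDr. Qed.

Lemma sign_avgZ n (k : R) phi c :
  sign_avg n (fun s => k * phi s) c = k * sign_avg n phi c.
Proof. by rewrite /sign_avg -mulr_sumr mulrCA. Qed.

Lemma sign_avg_cst n (k : R) c : sign_avg n (fun=> k) c = k.
Proof.
rewrite /sign_avg sumr_const card_ord -[k *+ _]mulr_natr natrX mulrCA -exprMn mulVf//.
by rewrite expr1n mulr1.
Qed.

Lemma sign_sumD n c d j :
  sign_sum n (fun i => c i + d i) j = sign_sum n c j + sign_sum n d j.
Proof. by rewrite /sign_sum -big_split; apply: eq_bigr => i _; rewrite mulrDr. Qed.

Lemma sign_sumZ n (k : R) c j : sign_sum n (fun i => k * c i) j = k * sign_sum n c j.
Proof. by rewrite /sign_sum mulr_sumr; apply: eq_bigr => i _; rewrite mulrCA. Qed.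

Lemma eq_sign_sum n c d j :
  (forall i, (i < n)%N -> c i = d i) -> sign_sum n c j = sign_sum n d j.
Proof. by move=> cd; apply: eq_bigr => i _; rewrite cd. Qed.

Lemma eq_sign_avg n phi c d :
  (forall i, (i < n)%N -> c i = d i) -> sign_avg n phi c = sign_avg n phi d.
Proof.
by move=> cd; congr (_ * _); apply: eq_bigr => j _; rewrite (eq_sign_sum _ cd).
Qed.

Variable p : R.
Local Notation rad n c := (sign_avg n (fun s => `|s| `^ p) c).

Lemma sign_avg_powR_ge0 n c : 0 <= rad n c.
Proof.
by rewrite mulr_ge0 ?exprn_ge0 ?invr_ge0//; apply: sumr_ge0 => j _; exact: powR_ge0.
Qed.

Lemma sign_avg_powRS n c : 2 <= p -> rad n c + `|c n| `^ p <= rad n.+1 c.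
Proof.
move=> p2; rewrite sign_avgS -[X in _ + X <= _](sign_avg_cst n _ c) -sign_avgD.
by apply: ler_sign_avg => s; exact: powR_parallelogram.
Qed.

Lemma sign_avg_cotype n c : 2 <= p -> \sum_(i < n) `|c i| `^ p <= rad n c.
Proof.
move=> p2; elim: n => [|n IH]; first by rewrite big_ord0 sign_avg_powR_ge0.
by rewrite big_ord_recr /=; apply: le_trans (sign_avg_powRS _ _ p2); rewrite lerD2r.
Qed.

Lemma sign_avg_homo c : 2 <= p -> {homo (fun n => rad n c) : m n / (m <= n)%N >-> m <= n}.
Proof.
move=> p2; apply: homo_leq => [//|y x z|n]; first exact: le_trans.
by apply: le_trans (sign_avg_powRS _ _ p2); rewrite lerDl powR_ge0.
Qed.

Lemma sign_avg_powRD n c d : 0 <= p ->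
  rad n (fun i => c i + d i) <= 2 `^ p * (rad n c + rad n d).
Proof.
move=> p0; rewrite /sign_avg -mulrDr mulrCA ler_wpM2l ?exprn_ge0 ?invr_ge0//.
rewrite -big_split mulr_sumr; apply: ler_sum => j _.
by rewrite sign_sumD; exact: powR_normD.
Qed.

Lemma sign_avg_sqr n c : sign_avg n (fun s => s ^+ 2) c = \sum_(i < n) c i ^+ 2.
Proof.
elim: n => [|n IH]; first by rewrite big_ord0 sign_avg0 expr0n.
rewrite sign_avgS big_ord_recr /= -IH -[X in _ + X](sign_avg_cst n _ c) -sign_avgD.
by congr sign_avg; apply/funext => s; field.
Qed.

(** Khinchine's inequality for the fourth moment. With second moment [v], adding the term [w] adds
    [6 w^2 v + w^4] on the left, which is at most the increment [6 w^2 v + 3 w^4] of [3 v^2]. *)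
Lemma sign_avg_pow4 n c :
  sign_avg n (fun s => s ^+ 4) c <= 3 * (\sum_(i < n) c i ^+ 2) ^+ 2.
Proof.
elim: n => [|n IH]; first by rewrite big_ord0 sign_avg0 !expr0n mulr0.
rewrite sign_avgS big_ord_recr /= -sign_avg_sqr.
have -> : sign_avg n (fun s => ((s + c n) ^+ 4 + (s - c n) ^+ 4) / 2) c =
    sign_avg n (fun s => s ^+ 4) c + 6 * c n ^+ 2 * sign_avg n (fun s => s ^+ 2) c
    + c n ^+ 4.
  rewrite -sign_avgZ -[X in _ + X](sign_avg_cst n _ c) -!sign_avgD.
  by congr sign_avg; apply/funext => s; field.
rewrite -sign_avg_sqr in IH; have := sqr_ge0 (c n ^+ 2); move: IH.
set u := sign_avg _ _ _; set v := sign_avg _ _ _; set w := c n; nra.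
Qed.

(** By Cauchy-Schwarz the fourth moment is at most
    [3 * (\sum a_i^4) * (\sum y_i^4)], and [l_p] embeds contractively into
    [l_4]; this is where [p <= 4] enters. *)
Lemma sign_avg_powRM_le n (a y : nat -> R) : 0 < p -> p <= 4 ->
  rad n (fun i => a i * y i) <=
  4 * (\sum_(i < n) `|a i| `^ p) * (\sum_(i < n) `|y i| `^ p).
Proof.
move=> p0 p4; set A := \sum_(i < n) _; set Y := \sum_(i < n) _.
have sum_ge0 (c : nat -> R) : 0 <= \sum_(i < n) `|c i| `^ p.
  by apply: sumr_ge0 => i _; exact: powR_ge0.
have sum_eq0 (c : nat -> R) : \sum_(i < n) `|c i| `^ p = 0 ->
    forall i, (i < n)%N -> c i = 0.
  move=> /eqP; rewrite psumr_eq0; last by move=> *; exact: powR_ge0.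
  move=> /allP c0 i ilt; have := c0 (Ordinal ilt); rewrite mem_index_enum => /(_ isT)/=.
  by rewrite powR_eq0 normr_eq0 => /andP[/eqP].
have rad0 (c : nat -> R) : (forall i, (i < n)%N -> c i = 0) -> rad n c = 0.
  move=> c0; rewrite (@eq_sign_avg _ _ _ (fun=> 0))//.
  rewrite /sign_avg big1 ?mulr0// => j _.
  by rewrite /sign_sum big1 ?normr0 ?powR0 ?gt_eqF// => i _; rewrite mulr0.
have [A0|An0] := eqVneq A 0.
  by rewrite A0 mulr0 mul0r rad0// => i /(sum_eq0 _ A0) ->; rewrite mul0r.
have [Y0|Yn0] := eqVneq Y 0.
  by rewrite Y0 mulr0 rad0// => i /(sum_eq0 _ Y0) ->; rewrite mulr0.
(* By homogeneity both sequences may be scaled to the unit sphere of l_p, where every entry is at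
   most 1 in absolute value and fourth powers are below [p]-th powers. *)
have norm4 (c : nat -> R) : \sum_(i < n) `|c i| `^ p != 0 ->
    exists C, [/\ 0 < C, \sum_(i < n) `|c i| `^ p = C `^ p &
      \sum_(i < n) (c i / C) ^+ 4 <= 1].
  set S := \sum_(i < n) _ => Sn0.
  have S0 : 0 < S by rewrite lt_neqAle eq_sym Sn0 sum_ge0.
  have [C [C0 CpE]] : exists C, 0 < C /\ C `^ p = S.
    by exists (S `^ p^-1); rewrite powR_gt0// powRVK ?gt_eqF// ltW.
  exists C.
  have CVp : C^-1 `^ p = S^-1.
    by rewrite -(powR_inv1 (ltW C0)) powRAC CpE powR_inv1// ltW.
  have CV0 : 0 <= C^-1 by rewrite invr_ge0 ltW.
  have cE i : `|c i / C| `^ p = `|c i| `^ p / S.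
    by rewrite normrM (ger0_norm CV0) powRM// CVp.
  split=> //; apply: (@le_trans _ _ (\sum_(i < n) `|c i / C| `^ p)).
    apply: ler_sum => i _; apply: expr4_le_powR => //; rewrite cE ler_pdivrMr// mul1r.
    by rewrite /S (bigD1 i)//= lerDl sumr_ge0// => *; exact: powR_ge0.
  by under eq_bigr do rewrite cE; rewrite -mulr_suml divff.
have [C [a0 AE a4]] := norm4 a An0; have [D [y0 YE y4]] := norm4 y Yn0.
rewrite /A /Y AE YE.
have CD0 : 0 < C * D by rewrite mulr_gt0.
pose c i := (a i / C) * (y i / D).
have -> : rad n (fun i => a i * y i) = (C * D) `^ p * rad n c.
  rewrite /sign_avg mulrCA; congr (_ * _); rewrite mulr_sumr; apply: eq_bigr => j _.
  have -> : sign_sum n (fun i => a i * y i) j = (C * D) * sign_sum n c j.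
    rewrite -sign_sumZ; apply: eq_sign_sum => i _; rewrite /c.
    by field; rewrite (gt_eqF a0) (gt_eqF y0).
  by rewrite normrM (gtr0_norm CD0) (powRM _ (ltW CD0)).
rewrite (powRM _ (ltW a0) (ltW y0)).
have -> : 4 * C `^ p * D `^ p = C `^ p * D `^ p * 4 by ring.
rewrite ler_wpM2l ?mulr_ge0 ?powR_ge0//.
(* The constant 4 is [1 + 3]: the 1 covers small values of [s], the 3 comes from the fourth
   moment. *)
apply: (@le_trans _ _ (sign_avg n (fun s => 1 + s ^+ 4) c)).
  by apply: ler_sign_avg => s; apply: powR_le1D4 => //; exact: ltW.
rewrite sign_avgD sign_avg_cst.
suff : (\sum_(i < n) c i ^+ 2) ^+ 2 <= 1 by have := sign_avg_pow4 n c; lra.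
have c20 : 0 <= \sum_(i < n) c i ^+ 2 by apply: sumr_ge0 => i _; exact: sqr_ge0.
rewrite expr_le1//.
apply: (@le_trans _ _ (\sum_(i < n) ((a i / C) ^+ 4 + (y i / D) ^+ 4) / 2)).
  apply: ler_sum => i _; rewrite /c; set u := a i / C; set v := y i / D.
  by have := sqr_ge0 (u ^+ 2 - v ^+ 2); nra.
by rewrite -mulr_suml big_split /=; lra.
Qed.

End SignAverages.

(** * L_p functions *)

Section LpBasics.
Context {disp} {T : measurableType disp} {R : realType}.
Variables (mu : {measure set T -> \bar R}) (p : R).
Hypothesis p1 : 1 <= p.
Implicit Types f g : T -> R.

Let p0 : 0 < p. Proof. exact: lt_le_trans p1. Qed.
Let pn0 : p != 0. Proof. by rewrite gt_eqF. Qed.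

Definition Lp_int (q : R) f : \bar R := (\int[mu]_t (`|f t| `^ q)%:E)%E.

Definition in_Lp f : Prop := measurable_fun setT f /\ finite_norm mu p%:E f.

Definition norm_p f : R := fine ('N[mu]_p%:E[EFin \o f])%E.

Lemma measurable_powR_norm q f :
  measurable_fun setT f -> measurable_fun [set: T] (EFin \o (fun t => `|f t| `^ q)).
Proof.
move=> mf; apply/measurable_EFinP; apply: (measurableT_comp (measurable_powR q)).
exact: measurableT_comp.
Qed.

Lemma Lnorm_Lp_int f : ('N[mu]_p%:E[EFin \o f] `^ p)%E = Lp_int p f.
Proof. by rewrite poweR_Lnorm. Qed.

Lemma norm_p_ge0 f : 0 <= norm_p f.
Proof. exact/fine_ge0/Lnorm_ge0. Qed.

Lemma norm_pE f : in_Lp f -> ('N[mu]_p%:E[EFin \o f])%E = (norm_p f)%:E.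
Proof. by move=> [_ ff]; rewrite fineK// ge0_fin_numE ?Lnorm_ge0. Qed.

Lemma in_Lp_int f : in_Lp f -> Lp_int p f = (norm_p f `^ p)%:E.
Proof. by move=> Lf; rewrite -Lnorm_Lp_int norm_pE. Qed.

Lemma in_LpP f : measurable_fun setT f -> (Lp_int p f < +oo)%E -> in_Lp f.
Proof. by move=> mf ff; split=> //; apply: (lty_poweRy pn0); rewrite Lnorm_Lp_int. Qed.

Lemma norm_p_le f c : 0 <= c -> in_Lp f -> (Lp_int p f <= (c `^ p)%:E)%E ->
  norm_p f <= c.
Proof.
move=> c0 Lf; rewrite (in_Lp_int Lf) lee_fin => le.
rewrite -(powRK pn0 (norm_p_ge0 f)) -(powRK pn0 c0).
by apply: powR_le; rewrite ?invr_ge0 ?(ltW p0)// powR_ge0.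
Qed.

Let LnormD f g : in_Lp f -> in_Lp g ->
  ('N[mu]_p%:E[EFin \o (fun t => f t + g t)%R] <=
   'N[mu]_p%:E[EFin \o f] + 'N[mu]_p%:E[EFin \o g])%E.
Proof.
move=> [mf _] [mg _]; have p1e : (1%:E <= p%:E)%E by rewrite lee_fin.
exact: (@eminkowski _ _ R mu f g p%:E mf mg p1e).
Qed.

Lemma in_LpD f g : in_Lp f -> in_Lp g -> in_Lp (fun t => f t + g t).
Proof.
move=> Lf Lg; split; first by apply: measurable_funD; [exact: Lf.1|exact: Lg.1].
apply: le_lt_trans (LnormD Lf Lg) _.
by rewrite lte_add_pinfty//; [exact: Lf.2|exact: Lg.2].
Qed.

Lemma norm_pD f g : in_Lp f -> in_Lp g ->
  norm_p (fun t => f t + g t) <= norm_p f + norm_p g.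
Proof.
by move=> Lf Lg; rewrite -lee_fin EFinD -!norm_pE//; [exact: LnormD|exact: in_LpD].
Qed.

Lemma Lp_int_scale c f : 0 <= c -> measurable_fun setT f ->
  (\int[mu]_t (c * `|f t| `^ p)%:E)%E = (c%:E * Lp_int p f)%E.
Proof.
move=> c0 mf; rewrite /Lp_int.
have f0 t : [set: T] t -> (0 <= (`|f t| `^ p)%:E)%E by rewrite lee_fin powR_ge0.
rewrite -(ge0_integralZl_EFin mu measurableT f0 (measurable_powR_norm p mf) c0).
by apply: eq_integral => t _; rewrite EFinM.
Qed.

Lemma Lp_intZ c f : measurable_fun setT f ->
  Lp_int p (fun t => c * f t) = ((`|c| `^ p)%:E * Lp_int p f)%E.
Proof.
move=> mf; rewrite -Lp_int_scale ?powR_ge0//.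
by apply: eq_integral => t _; rewrite normrM powRM.
Qed.

Lemma in_LpZ c f : in_Lp f -> in_Lp (fun t => c * f t).
Proof.
move=> Lf; apply: in_LpP; first by apply: measurable_funM => //; exact: Lf.1.
by rewrite (Lp_intZ _ Lf.1) (in_Lp_int Lf) -EFinM ltry.
Qed.

Lemma norm_pZ c f : in_Lp f -> norm_p (fun t => c * f t) = `|c| * norm_p f.
Proof.
move=> Lf; have := Lp_intZ c Lf.1.
rewrite (in_Lp_int Lf) (in_Lp_int (in_LpZ c Lf)) -EFinM => -[].
rewrite -powRM ?norm_p_ge0// => /(congr1 (fun x => x `^ p^-1)).
by rewrite !powRK// ?mulr_ge0// norm_p_ge0.
Qed.

Lemma in_LpB f g : in_Lp f -> in_Lp g -> in_Lp (fun t => f t - g t).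
Proof.
move=> Lf Lg; have := in_LpD Lf (in_LpZ (-1) Lg).
by under eq_fun do rewrite mulN1r.
Qed.

End LpBasics.

Lemma cvg_powR_norm {R : realType} (p : R) (y : nat -> R) (l : R) : 0 < p ->
  y n @[n --> \oo] --> l -> `|y n| `^ p @[n --> \oo] --> `|l| `^ p.
Proof.
(* The power is differentiable away from 0; at 0 continuity is checked directly. *)
move=> p0 yl; have [l0|l0] := eqVneq l 0.
  rewrite l0 normr0 powR0 ?gt_eqF//; apply/cvgrPdist_le => e e0.
  have /cvgrPdist_le/(_ (e `^ p^-1)) := yl; rewrite powR_gt0// => /(_ isT).
  apply: filterS => n; rewrite l0 !sub0r !normrN (ger0_norm (powR_ge0 _ _)) => le.
  by rewrite -(powRVK (lt0r_neq0 p0) (ltW e0)); apply: powR_le; rewrite ?(ltW p0).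
apply: (@continuous_cvg _ _ _ _ _ _ (fun x : R => x `^ p)); last exact: cvg_norm.
apply: differentiable_continuous; apply/derivable1_diffP; apply: derivable_powR.
by rewrite in_itv /= andbT normr_gt0.
Qed.

(** * Completeness of L_p *)

Section LpComplete.
Context {disp} {T : measurableType disp} {R : realType}.
Variables (mu : {measure set T -> \bar R}) (p : R).
Hypothesis p1 : 1 <= p.

Let p0 : 0 < p. Proof. exact: lt_le_trans p1. Qed.

(** The increments are weighted by [2 ^ n] before taking [p]-th powers. The integrals are then at
    most [(2 ^ n / 4 ^ n) ^ p], hence summable, and finiteness of the sum at [t] forces the
    increments there to decay like [2 ^ - n]. *)
Lemma Lp_rapid_cvg_ae (u : nat -> T -> R) : (forall n, in_Lp mu p (u n)) ->
  (forall n, norm_p mu p (fun t => u n.+1 t - u n t) <= 4^-1 ^+ n) ->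
  {ae mu, forall t, exists l : R, u n t @[n --> \oo] --> l}.
Proof.
move=> Lu hu; pose d n t := u n.+1 t - u n t.
have Ld n : in_Lp mu p (d n) by apply: in_LpB => //; exact: p1.
pose w n : R := (2 ^+ n) `^ p.
have w0 n : 0 <= w n by exact: powR_ge0.
pose G t : \bar R := (\sum_(n <oo) (w n * `|d n t| `^ p)%:E)%E.
have mterm n : measurable_fun setT (fun t => (w n * `|d n t| `^ p)%:E).
  apply/measurable_EFinP; apply: measurable_funM => //.
  by apply/measurable_EFinP; exact: measurable_powR_norm (Ld n).1.
have term0 n t : (0 <= (w n * `|d n t| `^ p)%:E)%E.
  by rewrite lee_fin mulr_ge0// powR_ge0.
have mG : measurable_fun setT G.
  by apply: ge0_emeasurable_sum => n *; [exact: term0|exact: mterm].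
have intG : (\int[mu]_t G t < +oo)%E.
  rewrite integral_nneseries//.
  apply: (@le_lt_trans _ _ (\sum_(n <oo) (geometric 1 2^-1 n)%:E)%E).
    apply: lee_nneseries => n _; first by move=> _; exact: integral_ge0.
    rewrite Lp_int_scale ?in_Lp_int// -?EFinM ?lee_fin /= ?mul1r; last exact: (Ld n).1.
    rewrite /w -powRM ?norm_p_ge0 ?exprn_ge0//.
    apply: (@le_trans _ _ ((2^-1 ^+ n) `^ p)).
      apply: powR_le; first exact: ltW.
        by rewrite mulr_ge0 ?norm_p_ge0 ?exprn_ge0.
      apply: le_trans (ler_wpM2l _ (hu n)) _; first exact: exprn_ge0.
      rewrite -exprMn; have -> : 2 / 4 = 2^-1 :> R by lra.
      by [].
    apply: ge1r_powR => //; rewrite exprn_gt0 ?invr_gt0//=.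
    by rewrite exprn_ile1 ?invr_ge0// invf_le1// ler1n.
  have cv : cvgn (series (geometric (1 : R) 2^-1)).
    by apply: is_cvg_geometric_series; rewrite ger0_norm ?invr_ge0// invf_lt1// ltr1n.
  rewrite (_ : (\sum_(n <oo) _)%E = (limn (series (geometric (1 : R) 2^-1)))%:E) ?ltry//.
  rewrite -EFin_lim//; apply: congr_lim; apply/funext => n.
  by rewrite /= sumEFin.
have iG : mu.-integrable setT G.
  apply/integrableP; split=> //.
  under eq_integral do rewrite gee0_abs ?nneseries_ge0//.
  exact: intG.
have := integrable_ae (measurableT) iG; apply: filterS => t /(_ I) Gfin.
pose S := fine (G t).
have SE : G t = S%:E by rewrite fineK.
have dS n : w n * `|d n t| `^ p <= S.
  rewrite -lee_fin -SE; apply: le_trans (nneseries_lim_ge n.+1 _) => [|//].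
  rewrite big_nat_recr//= leeDr// sume_ge0// => i _; exact: term0.
have S0 : 0 <= S by apply: le_trans (dS 0%N); rewrite mulr_ge0// powR_ge0.
have dB n : `|d n t| <= S `^ p^-1 * 2^-1 ^+ n.
  have := dS n; rewrite /w -powRM ?exprn_ge0// => le.
  have pV0 : 0 <= p^-1 by rewrite invr_ge0 ltW.
  have := powR_le pV0 (powR_ge0 _ _) le; rewrite powRK ?gt_eqF// ?mulr_ge0 ?exprn_ge0//.
  by rewrite exprVn ler_pdivlMr ?exprn_gt0// mulrC.
have [l hl] := geometric_limit dB.
exists (u 0%N t + l).
have uE n : u n t = u 0%N t + \sum_(k < n) d k t.
  elim: n => [|n IH]; first by rewrite big_ord0 addr0.
  by rewrite big_ord_recr /= addrA -IH /d addrC subrK.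
have cv : (2 * S `^ p^-1 * 2^-1 ^+ n) @[n --> \oo] --> (0 : R).
  by apply: cvg_geometric; rewrite ger0_norm ?invr_ge0// invf_lt1// ltr1n.
apply/cvgrPdist_le => e e0; have /cvgrPdist_le/(_ e e0) := cv.
apply: filterS => n; rewrite sub0r normrN => hn.
rewrite (uE n) opprD addrACA subrr add0r; apply: le_trans (hl n) _.
by apply: le_trans hn; rewrite ler_norm.
Qed.

Lemma Lp_fatou (v : nat -> T -> R) (x : T -> R) (c : \bar R) :
  (forall n, measurable_fun setT (v n)) -> measurable_fun setT x ->
  (forall n, (Lp_int mu p (v n) <= c)%E) ->
  {ae mu, forall t, v n t @[n --> \oo] --> x t} -> (Lp_int mu p x <= c)%E.
Proof.
move=> mv mx vc vx.
pose g n t := (`|v n t| `^ p)%:E.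
have mg n : measurable_fun setT (g n) by exact: measurable_powR_norm.
have g0 n t : setT t -> (0 <= g n t)%E by move=> _; rewrite lee_fin powR_ge0.
have lim_le (y : nat -> \bar R) (b : \bar R) : (forall n, (y n <= b)%E) -> (limn_einf y <= b)%E.
  move=> yb; rewrite limn_einf_lim; apply: lime_le; first exact: is_cvg_einfs.
  apply: nearW => n; apply: le_trans (yb n); apply: ereal_inf_lbound.
  by exists n => //=.
have := fatou mu measurableT mg g0 => /le_trans /(_ (lim_le _ c _)).
move=> H; apply: le_trans (H _); last by move=> n; exact: vc.
rewrite le_eqVlt; apply/orP; left; apply/eqP.
apply: ge0_ae_eq_integral => //.
- exact: measurable_powR_norm.
- rewrite [X in measurable_fun _ X](_ : _ =
      (fun t => - limn_esup (fun n => - g n t))%E); last first.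
    by apply/funext => t; rewrite [limn_esup _]limn_esupN oppeK.
  by apply: measurableT_comp => //; apply: measurable_fun_limn_esup => n; exact: measurableT_comp.
- move=> t _; rewrite limn_einf_lim; apply: lime_ge; first exact: is_cvg_einfs.
  by apply: nearW => n; apply: le_ereal_inf_tmp => _ [k _ <-]; exact: g0.
- apply: filterS vx => t /= vt _.
  have cv : g n t @[n --> \oo] --> (`|x t| `^ p)%:E.
    apply: cvg_EFin; first exact: nearW.
    exact: cvg_powR_norm.
  by have [-> _] := cvg_limn_einf_sup cv.
Qed.

(** The upper limit is a measurable candidate defined everywhere, and it is the limit almost
    everywhere. Fatou's lemma for the differences [u n - u (n + m)] as [m] grows gives the rate, and
    with it membership in L_p. *)
Lemma Lp_complete (u : nat -> T -> R) : (forall n, in_Lp mu p (u n)) ->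
  (forall n, norm_p mu p (fun t => u n.+1 t - u n t) <= 4^-1 ^+ n) ->
  exists2 x, in_Lp mu p x & forall n, norm_p mu p (fun t => u n t - x t) <= 2 * 4^-1 ^+ n.
Proof.
move=> Lu hu.
pose x t := fine (limn_esup (fun n => (u n t)%:E)).
have mx : measurable_fun setT x.
  apply: measurableT_comp => //; apply: measurable_fun_limn_esup => n.
  exact/measurable_EFinP/(Lu n).1.
have ux : {ae mu, forall t, u n t @[n --> \oo] --> x t}.
  apply: filterS (Lp_rapid_cvg_ae Lu hu) => t [l ul]; rewrite /x.
  have cv : (u n t)%:E @[n --> \oo] --> l%:E by apply: cvg_EFin => //; exact: nearW.
  by have [_ ->] := cvg_limn_einf_sup cv.
have q0 n : 0 <= 4^-1 ^+ n :> R by rewrite exprn_ge0// invr_ge0.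
have dist n m : norm_p mu p (fun t => u n t - u (n + m)%N t) <=
    2 * 4^-1 ^+ n - 2 * 4^-1 ^+ (n + m).
  elim: m => [|m IH].
    rewrite addn0 subrr (_ : (fun t => _) = (fun t => 0 * u n t)) ?norm_pZ ?normr0 ?mul0r//.
    by apply/funext => t; rewrite subrr mul0r.
  rewrite (_ : (fun t => _) = (fun t => (u n t - u (n + m)%N t) +
      (-1) * (u (n + m).+1 t - u (n + m)%N t))); last first.
    by apply/funext => t; rewrite addnS mulN1r opprB addrA subrK.
  apply: le_trans (norm_pD p1 _ (in_LpZ p1 _ _)) _; try exact: in_LpB.
  rewrite norm_pZ ?normrN1 ?mul1r; [|exact: p1|exact: in_LpB].
  have := hu (n + m)%N; rewrite addnS exprS; have := q0 (n + m)%N; move: IH; lra.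
have intx n : (Lp_int mu p (fun t => u n t - x t)%R <= ((2 * 4^-1 ^+ n) `^ p)%:E)%E.
  apply: (@Lp_fatou (fun m t => u n t - u (n + m)%N t)).
  - by move=> m; apply: measurable_funB; [exact: (Lu _).1|exact: (Lu _).1].
  - by apply: measurable_funB => //; exact: (Lu _).1.
  - move=> m; rewrite in_Lp_int ?lee_fin//; last exact: in_LpB.
    apply: powR_le; [exact: ltW|exact: norm_p_ge0|].
    by apply: le_trans (dist n m) _; rewrite gerBl mulr_ge0.
  - apply: filterS ux => t ut; apply: cvgB; first exact: cvg_cst.
    have -> : (fun m => u (n + m)%N t) = [sequence u (m + n)%N t]_m.
      by apply/funext => m; rewrite addnC.
    by rewrite (cvg_shiftn n (fun m => u m t)).
have Lux n : in_Lp mu p (fun t => u n t - x t).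
  apply: in_LpP => //; first by apply: measurable_funB => //; exact: (Lu _).1.
  by apply: le_lt_trans (intx n) _; exact: ltry.
exists x => [|n].
  rewrite (_ : x = (fun t => u 0%N t - (u 0%N t - x t))); first exact: in_LpB.
  by apply/funext => t; rewrite opprB addrC subrK.
by apply: norm_p_le => //; rewrite mulr_ge0.
Qed.

End LpComplete.

(** * Translations *)

Section Translation.
Context {R : realType}.
Local Notation mu := (@lebesgue_measure R).

Lemma lebesgue_measure_shift (a : R) (A : set R) : measurable A ->
  pushforward mu ((fun x => x - a) : _ -> measurableTypeR R) A = mu A.
Proof.
have mphi : measurable_fun [set: R] ((fun x => x - a) : R -> R).
  by apply: measurable_funB => //; exact: measurable_cst.
move=> mA; apply/esym/lebesgue_measure_unique => //= _ [[x y]] _ <-.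
rewrite /pushforward.
rewrite (_ : _ @^-1` _ = [set` `]x + a, y + a]]); last first.
  by apply/seteqP; split => t /=; rewrite !in_itv /= ltrBrDr lerBlDr.
rewrite /= !lebesgue_measure_itv/= !lte_fin ltrD2r -!EFinD.
by case: ifP => // _; congr (_%:E); ring.
Qed.

Lemma ge0_integral_shift (g : R -> \bar R) (A : set R) (a : R) :
  measurable A -> measurable_fun setT g -> (forall t, (0 <= g t)%E) ->
  (\int[mu]_(t in A) g (t - a)%R = \int[mu]_(s in [set s | A (s + a)%R]) g s)%E.
Proof.
move=> mA mg g0.
have mphi : measurable_fun [set: R] ((fun x => x - a) : R -> R).
  by apply: measurable_funB => //; exact: measurable_cst.
have mA' : measurable [set s | A (s + a)].
  rewrite -[X in measurable X]setTI.
  have mpsi : measurable_fun [set: R] ((fun x => x + a) : R -> R).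
    by apply: measurable_funD => //; exact: measurable_cst.
  exact: mpsi.
rewrite [in LHS](_ : A = (fun x => x - a) @^-1` [set s | A (s + a)]); last first.
  by apply/seteqP; split => t /=; rewrite subrK.
rewrite -[LHS](@ge0_integral_pushforward _ _ _ _ _
  (fun x : measurableTypeR R => (x - a : measurableTypeR R)) mphi mu)//=; last exact: measurable_funS mg.
by apply: eq_measure_integral => //= B mB BS; exact: lebesgue_measure_shift.
Qed.


Lemma measurable_translate (f : R -> R) (a : R) :
  measurable_fun setT f -> measurable_fun setT (translate f a).
Proof.
move=> mf; apply: (measurableT_comp mf).
by apply: measurable_funB => //; exact: measurable_cst.
Qed.

Lemma Lp_int_translate q (f : R -> R) a : measurable_fun setT f ->
  Lp_int mu q (translate f a) = Lp_int mu q f.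
Proof.
move=> mf.
have := @ge0_integral_shift (fun t => (`|f t| `^ q)%:E) setT a measurableT
  (measurable_powR_norm q mf).
by apply=> t; rewrite lee_fin powR_ge0.
Qed.

Lemma norm_p_Lp_int p (f : R -> R) : norm_p mu p f = fine (Lp_int mu p f `^ p^-1).
Proof. by rewrite /norm_p unlock. Qed.

Lemma norm_p_translate p (f : R -> R) a : measurable_fun setT f ->
  norm_p mu p (translate f a) = norm_p mu p f.
Proof. by move=> mf; rewrite !norm_p_Lp_int Lp_int_translate. Qed.

Lemma in_Lp_translate p (f : R -> R) a : 1 <= p -> in_Lp mu p f ->
  in_Lp mu p (translate f a).
Proof.
move=> p1 Lf; apply: in_LpP => //; first exact: measurable_translate Lf.1.
by rewrite Lp_int_translate ?(in_Lp_int p1 Lf) ?ltry//; exact: Lf.1.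
Qed.

Definition translation_continuous (p : R) (f : R -> R) : Prop :=
  forall e : R, 0 < e -> exists2 delta : R, 0 < delta & forall h, `|h| <= delta ->
    norm_p mu p (fun t => translate f h t - f t) <= e.

(** Translation is isometric, so the approximation error is paid twice, and the modulus of [v] takes
    the last third. *)
Lemma translation_continuous_closure (p : R) (u : R -> R) : 1 <= p -> in_Lp mu p u ->
  (forall e, 0 < e -> exists v, [/\ in_Lp mu p v, translation_continuous p v &
     norm_p mu p (fun t => u t - v t) <= e]) ->
  translation_continuous p u.
Proof.
move=> p1 Lu H e e0; have e3 : 0 < e / 3 by rewrite divr_gt0.
have [v [Lv cv uv]] := H _ e3; have [delta delta0 hd] := cv _ e3.
exists delta => // h /hd vh.
have Luv : in_Lp mu p (fun t => u t - v t) by exact: in_LpB.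
have Lth : in_Lp mu p (fun t => translate v h t - v t).
  by apply: in_LpB => //; exact: in_Lp_translate.
have -> : (fun t => translate u h t - u t) = (fun t =>
    (translate (fun t => u t - v t) h t + (-1) * (u t - v t)) +
    (translate v h t - v t)).
  by apply/funext => t; rewrite /translate; ring.
have Ltr := in_Lp_translate h p1 Luv; have LN := in_LpZ p1 (-1) Luv.
apply: le_trans (norm_pD p1 (in_LpD p1 Ltr LN) Lth) _.
have := norm_pD p1 Ltr LN; rewrite norm_p_translate; last exact: Luv.1.
rewrite (norm_pZ p1 (-1) Luv) normrN1 mul1r; move: uv vh.
set x1 := norm_p _ _ _; set x2 := norm_p _ _ _; set x3 := norm_p _ _ _.
by move=> *; lra.
Qed.

Lemma Lp_int1 (f : R -> R) : Lp_int mu 1 f = (\int[mu]_t `|(f t)%:E|)%E.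
Proof. by apply: eq_integral => t _; rewrite powRr1. Qed.

(** Dominated convergence along a sequence of shifts tending to 0 that would violate the claim;
    shifts of size at most 1 keep the differences supported in [[- (K + 1), K + 1]] and bounded by
    [2 * B]. *)
Lemma L1_translation_compact (v : R -> R) (K : R) : continuous v ->
  (forall t, K < `|t| -> v t = 0) -> in_Lp mu 1 v /\ translation_continuous 1 v.
Proof.
move=> cv v0; wlog K0 : K v0 / 0 <= K.
  move=> H; apply: (H `|K|) => // t /(le_lt_trans (ler_norm K)); exact: v0.
have mv : measurable_fun setT v by exact: continuous_measurable_fun.
have [B [B0 vB]] : exists B, 0 <= B /\ forall t, `|v t| <= B.
  have KK : - K <= K by rewrite (le_trans _ K0)// oppr_le0.
  have cn : {within `[- K, K], continuous (fun t => `|v t|)}.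
    by apply: continuous_subspaceT => t; apply: continuous_comp; [exact: cv|exact: norm_continuous].
  have [c _ hc] := EVT_max KK cn; exists `|v c|; split=> // t.
  have [tK|/v0 ->] := leP `|t| K; last by rewrite normr0.
  by apply: hc; rewrite in_itv /= -ler_norml.
pose E := [set` `[- (K + 1), K + 1]] : set R.
have mE : measurable E by exact: measurable_itv.
pose g t := ((2 * B) * \1_E t)%:E : \bar R.
have ig : mu.-integrable setT g.
  rewrite /g; under eq_fun do rewrite EFinM.
  by apply: integrableZl => //; exact: integrable_indic_itv.
have bound h t : `|h| <= 1 -> `|v (t - h) - v t| <= 2 * B * \1_E t.
  move=> h1; rewrite indicE; case: (boolP (t \in E)) => [_|].
    rewrite mulr1; apply: le_trans (ler_normB _ _) _.
    by rewrite mulr2n mulrDl mul1r lerD.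
  rewrite notin_setE /E /= in_itv /= => /negP; rewrite -ler_norml -ltNge => tK.
  rewrite mulr0 !v0 ?subrr ?normr0//; first by apply: lt_trans tK; rewrite ltrDl.
  have := ler_normD (t - h) h; rewrite subrK; lra.
have iv : mu.-integrable setT (EFin \o v).
  apply: (le_integrable measurableT _ _ ig); first exact/measurable_EFinP.
  move=> t _ /=; rewrite lee_fin [leRHS]ger0_norm ?mulr_ge0//.
  rewrite indicE; case: (boolP (t \in E)) => [_|].
    by rewrite mulr1; apply: le_trans (vB t) _; rewrite ler_peMl// ler1n.
  rewrite notin_setE /E /= in_itv /= => /negP; rewrite -ler_norml -ltNge => tK.
  by rewrite v0 ?normr0 ?mulr0//; apply: lt_trans tK; rewrite ltrDl.
have Lv : in_Lp mu 1 v.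
  by apply: in_LpP => //; rewrite Lp_int1; have /integrableP[] := iv.
split=> // e e0; apply: contrapT => H.
have {}H n : exists h : R, `|h| <= n.+1%:R^-1 /\
    e < norm_p mu 1 (fun t => translate v h t - v t).
  apply: contrapT => H'; apply: H; exists n.+1%:R^-1; first by rewrite invr_gt0.
  move=> h hn; rewrite leNgt; apply/negP => lt; apply: H'; by exists h.
have [h hh] := choice H.
have h0 : h n @[n --> \oo] --> (0 : R).
  apply/cvgrPdist_le => eps eps0; near=> n.
  rewrite sub0r normrN; apply: le_trans (hh n).1 _; apply: ltW.
  near: n; exact: near_infty_natSinv_lt (PosNum eps0).
pose f_ n t := (v (t - h n) - v t)%:E : \bar R.
have [] := @dominated_convergence _ _ _ mu setT measurableT f_ (cst 0%E) g.
- move=> n; apply/measurable_EFinP; apply: measurable_funB => //.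
  exact: measurable_translate.
- exact: measurable_cst.
- apply: aeW => t _; apply: cvg_EFin; first exact: nearW.
  rewrite -(subrr (v t)); apply: cvgB; last exact: cvg_cst.
  apply: (@continuous_cvg _ _ _ _ _ _ v); first exact: cv.
  by rewrite -[X in _ --> X]subr0; apply: cvgB => //; exact: cvg_cst.
- exact: ig.
- apply: aeW => t n _; rewrite lee_fin; apply: bound.
  by apply: le_trans (hh n).1 _; rewrite invf_le1// ler1n.
move=> _ cv0 _.
have : (e%:E <= 0)%E.
  rewrite -(cvg_lim _ cv0)//; apply: lime_ge; first exact: cvgP cv0.
  apply: nearW => n /=.
  rewrite (_ : \int[mu]_x _ = Lp_int mu 1 (fun t => translate v (h n) t - v t)%R)%E; last first.
    by rewrite Lp_int1; apply: eq_integral => t _; rewrite /f_ /cst /= subr0.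
  have Lth : in_Lp mu 1 (fun t => translate v (h n) t - v t).
    by apply: in_LpB => //; exact: in_Lp_translate.
  rewrite (in_Lp_int _ Lth)// lee_fin powRr1 ?norm_p_ge0//.
  exact: ltW (hh n).2.
by rewrite lee_fin leNgt e0.
Unshelve. all: by end_near. Qed.


Lemma Lp_int_le (p q c : R) (f g : R -> R) : 0 <= c ->
  measurable_fun setT f -> measurable_fun setT g ->
  (forall t, `|f t| `^ p <= c * `|g t| `^ q) ->
  (Lp_int mu p f <= c%:E * Lp_int mu q g)%E.
Proof.
move=> c0 mf mg fg; rewrite -(Lp_int_scale mu q c0 mg).
apply: ge0_le_integral => //.
- exact: measurable_powR_norm.
- apply/measurable_EFinP; apply: measurable_funM => //.
  by apply/measurable_EFinP; exact: measurable_powR_norm.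
- by move=> t _; rewrite lee_fin.
Qed.

(** The ramp that is 0 below 0, the identity on [0, 1] and 1 above 1; written with absolute values,
    it is visibly continuous. *)
Let clip (s : R) : R := (`|s| - `|s - 1| + 1) / 2.

Let clip_ge1 s : 1 <= s -> clip s = 1.
Proof. by move=> s1; rewrite /clip !ger0_norm; lra. Qed.

Let clip_le0 s : s <= 0 -> clip s = 0.
Proof. by move=> s0; rewrite /clip !ler0_norm; lra. Qed.

Let clip01 s : 0 <= clip s /\ clip s <= 1.
Proof.
have [s0|s0] := leP s 0; first by rewrite clip_le0.
have [s1|s1] := leP 1 s; first by rewrite clip_ge1.
by rewrite /clip ger0_norm ?ler0_norm; lra.
Qed.

Let L1_translation_bounded_support (w : R -> R) (K : R) :
  in_Lp mu 1 w -> (forall t, K < `|t| -> w t = 0) -> translation_continuous 1 w.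
Proof.
move=> Lw w0; apply: translation_continuous_closure => // e e0.
pose E := [set` `[- (K + 1), K + 1]] : set R.
have mE : measurable E by exact: measurable_itv.
have EP t : E t <-> `|t| <= K + 1 by rewrite /E /= in_itv /= -ler_norml.
have iw : mu.-integrable setT (EFin \o w).
  apply/integrableP; split; first by apply/measurable_EFinP; exact: Lw.1.
  by rewrite -Lp_int1 (in_Lp_int _ Lw)// ltry.
have iwE : mu.-integrable E (EFin \o w) by apply: integrableS iw.
have muE : (mu E < +oo)%E.
  by rewrite lebesgue_measure_itv /=; case: ifP => _; rewrite ?ltry.
have [g [cg ig gw]] := @approximation_continuous_integrable R E w mE muE iwE.
have [n hn] : exists n, (\int[mu]_(z in E) `|(w z - g n z)%:E| <= e%:E)%E.
  have /fine_cvgP[gfin /cvgrPdist_le/(_ e e0) gw0] := gw.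
  have [n _ /(_ n (leqnn n)) [/=]] := filterI gfin gw0.
  move=> fin; rewrite sub0r normrN => le; exists n.
  by rewrite -(fineK fin) lee_fin (le_trans _ le)// ler_norm.
(* The cutoff is 1 on the support of [w] and 0 outside [E]; in between [w] vanishes, so shrinking
   [g n] only improves the approximation. *)
pose v t := g n t * clip (K + 1 - `|t|).
have cv : continuous v.
  move=> t; apply: cvgM; first exact: cg.
  have cs : K + 1 - `|s| @[s --> t] --> K + 1 - `|t|.
    by apply: cvgB; [exact: cvg_cst|exact: norm_continuous].
  apply: cvgM; last exact: cvg_cst.
  apply: cvgD; last exact: cvg_cst.
  apply: cvgB; first exact: cvg_norm.
  by apply: cvg_norm; apply: cvgB => //; exact: cvg_cst.
have v0 t : K + 1 < `|t| -> v t = 0.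
  by move=> tK; rewrite /v clip_le0 ?mulr0//; lra.
have [Lv tv] := L1_translation_compact cv v0.
exists v; split=> //; apply: norm_p_le => //; [exact: ltW|exact: in_LpB|].
rewrite powRr1 ?(ltW e0)// Lp_int1; apply: le_trans hn.
rewrite [leRHS]integral_mkcond; apply: ge0_le_integral => //.
- apply: measurableT_comp => //; apply/measurable_EFinP.
  by apply: measurable_funB; [exact: Lw.1|exact: Lv.1].
- apply/(measurable_restrictT _ _).1 => //.
  apply: measurableT_comp => //; apply/measurable_EFinP.
  apply: measurable_funTS; apply: measurable_funB; first exact: Lw.1.
  by apply: continuous_measurable_fun; exact: cg.
move=> t _; rewrite patchE; case: ifPn => [_|].
  rewrite lee_fin /v; have [tK|tK] := leP `|t| K.
    by rewrite clip_ge1 ?mulr1//; lra.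
  rewrite w0// !sub0r !normrN normrM ler_piMr//.
  by have [c0 c1] := clip01 (K + 1 - `|t|); rewrite ger0_norm.
rewrite notin_setE => /EP /negP; rewrite -ltNge => tK.
have tK' : K < `|t| by apply: lt_trans tK; rewrite ltrDl.
by rewrite (v0 _ tK) (w0 _ tK') subrr abse_EFin normr0.
Qed.

Lemma L1_translation_continuous (u : R -> R) :
  in_Lp mu 1 u -> translation_continuous 1 u.
Proof.
move=> Lu; apply: translation_continuous_closure => // e e0.
have iu : mu.-integrable setT (EFin \o u).
  apply/integrableP; split; first by apply/measurable_EFinP; exact: Lu.1.
  by rewrite -Lp_int1 (in_Lp_int _ Lu)// ltry.
pose E n := [set` `[- n%:R, n%:R]] : set R.
have EP n t : E n t <-> `|t| <= n%:R by rewrite /E /= in_itv /= -ler_norml.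
pose w n t : R := u t * \1_(E n) t.
have mw n : measurable_fun [set: R] (w n).
  apply: measurable_funM; first exact: Lu.1.
  by apply: measurable_indic; exact: measurable_itv.
have wle n t : `|w n t| <= `|u t|.
  by rewrite /w indicE; case: (_ \in _); rewrite ?mulr1// mulr0 normr0.
have Lw n : in_Lp mu 1 (w n).
  apply: in_LpP => //; first exact: (mw n).
  apply: (@le_lt_trans _ _ (1%:E * Lp_int mu 1 u)%E).
    apply: (@Lp_int_le 1 1 1 (w n) u) => //; first exact: Lu.1.
    by move=> t; rewrite !powRr1// mul1r.
  by rewrite mul1e (in_Lp_int _ Lu)// ltry.
have tw n : translation_continuous 1 (w n).
  apply: (@L1_translation_bounded_support _ n%:R) => // t tn.
  rewrite /w indicE memNset ?mulr0// => /EP; rewrite leNgt tn//.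
have [] := @dominated_convergence _ _ _ mu setT measurableT
  (fun n => EFin \o w n) (EFin \o u) (fun t => `|(u t)%:E|%E).
- by move=> n; apply/measurable_EFinP; exact: (mw n).
- by apply/measurable_EFinP; exact: Lu.1.
- apply: aeW => t _; apply: cvg_EFin; first exact: nearW.
  apply: cvg_near_cst; near=> n; rewrite /= /w indicE mem_set ?mulr1//.
  apply/EP; near: n; exact: nbhs_infty_ger.
- exact: integrable_abse iu.
- by apply: aeW => t n _; rewrite lee_fin.
move=> _ /fine_cvgP[gfin /cvgrPdist_le/(_ e e0) gw0] _.
have [n _ /(_ n (leqnn n)) []] := filterI gfin gw0.
move=> /= fin; rewrite sub0r normrN => le; exists (w n); split=> //.
apply: norm_p_le => //; [exact: ltW|exact: in_LpB|].
rewrite powRr1 ?(ltW e0)// Lp_int1.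
have -> : (\int[mu]_x `|(u x - w n x)%R%:E| = \int[mu]_x `|(w n x)%:E - (u x)%:E|)%E.
  by apply: eq_integral => t _; rewrite -EFinB !abse_EFin distrC.
by rewrite -(fineK fin) lee_fin (le_trans _ le)// ler_norm.
Unshelve. all: by end_near. Qed.

(** The Mazur map transfers the case of L_1 to L_p. *)
Lemma Lp_translation_continuous (p : R) (f : R -> R) : 1 <= p ->
  in_Lp mu p f -> translation_continuous p f.
Proof.
move=> p1 Lf e e0; have p0 : 0 < p by rewrite (lt_le_trans ltr01).
pose u t := mazur p (f t).
have mu_ : measurable_fun [set: R] u.
  apply: measurable_funM; first exact: Lf.1.
  by apply/measurable_EFinP; apply: measurable_powR_norm; exact: Lf.1.
have Lu : in_Lp mu 1 u.
  apply: in_LpP => //; apply: (@le_lt_trans _ _ (1%:E * Lp_int mu p f)%E).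
    apply: (@Lp_int_le 1 p 1 u f) => //; first exact: Lf.1.
    by move=> t; rewrite powRr1// mul1r norm_mazur.
  by rewrite mul1e (in_Lp_int _ Lf)// ltry.
have e2 : 0 < (e / 2) `^ p by rewrite powR_gt0// divr_gt0.
have [delta delta0 hd] := L1_translation_continuous Lu e2.
exists delta => // h /hd uh.
have Lth : in_Lp mu p (fun t => translate f h t - f t).
  by apply: in_LpB => //; exact: in_Lp_translate.
have Luh : in_Lp mu 1 (fun t => translate u h t - u t).
  by apply: in_LpB => //; exact: in_Lp_translate.
apply: norm_p_le => //; first exact: ltW.
apply: (@le_trans _ _ ((2 `^ p)%:E * Lp_int mu 1 (fun t => translate u h t - u t)%R)%E).
  apply: Lp_int_le; [exact: powR_ge0|exact: Lth.1|exact: Luh.1|].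
  by move=> t; rewrite [X in _ * X]powRr1//; exact: mazur_dist.
rewrite (in_Lp_int _ Luh)// powRr1 ?norm_p_ge0// -EFinM lee_fin.
have -> : e `^ p = 2 `^ p * (e / 2) `^ p.
  by rewrite -powRM ?divr_ge0 ?(ltW e0)//; congr (_ `^ _); field.
by rewrite ler_wpM2l ?powR_ge0.
Qed.

End Translation.

(** * Discretization *)

Section Discretization.
Context {R : realType}.
Local Notation mu := (@lebesgue_measure R).

Lemma measurable_floor_level (g : R -> R) (z : int) : measurable_fun setT g ->
  measurable [set t | Num.floor (g t) = z].
Proof.
move=> mg; rewrite (_ : [set t | _] = setT `&` g @^-1` [set` `[z%:~R, (z + 1)%:~R[]).
  by apply: mg => //; exact: measurable_itv.
apply/seteqP; split => t /=.
  by move=> <-; split=> //; rewrite in_itv /=; exact: floor_itv.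
by rewrite in_itv /= => -[_ h]; exact: floor_def.
Qed.

Lemma measurable_fun_fibers {d d'} {T : measurableType d} {Y : measurableType d'}
    (phi : T -> nat) (G : nat -> Y) :
  (forall q, measurable (phi @^-1` [set q])) -> measurable_fun setT (fun t => G (phi t)).
Proof.
move=> mphi _ B mB; rewrite setTI.
rewrite (_ : _ @^-1` _ = \bigcup_(q in [set q | B (G q)]) phi @^-1` [set q]).
  by apply: bigcup_measurable => q _; exact: mphi.
apply/seteqP; split => t /=; first by move=> Bt; exists (phi t).
by move=> [q /= Bq ->].
Qed.

(** The cells are the intervals [[z * eta, (z + 1) * eta[] for integers [z], numbered through
    [pickle]; a number that is not a code has an empty fiber. *)
Lemma exists_cells (eta : R) : 0 < eta -> exists kappa : R -> nat,
  [/\ forall k, measurable (kappa @^-1` [set k]),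
      forall s t, kappa s = kappa t -> `|s - t| < eta &
      forall k, (mu (kappa @^-1` [set k]) <= eta%:E)%E].
Proof.
move=> eta0; pose kappa (t : R) := pickle (Num.floor (t / eta)).
have kE (t0 t : R) : kappa t = kappa t0 <-> t \in `[(Num.floor (t0 / eta))%:~R * eta,
    ((Num.floor (t0 / eta))%:~R + 1) * eta[.
  rewrite in_itv /= -ler_pdivlMr// -ltr_pdivrMr//; split.
    by move=> /(pcan_inj pickleK) <-; rewrite -[X in _ < _ + X]/(1%:~R) -intrD; exact: floor_itv.
  rewrite -[X in _ < _ + X]/(1%:~R) -intrD => h; congr pickle; exact: floor_def.
have fiber k : kappa @^-1` [set k] = set0 \/ exists z : int,
    kappa @^-1` [set k] = [set` `[z%:~R * eta, (z%:~R + 1) * eta[].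
  have [[t0 t0k]|no] := pselect (exists t, kappa t = k); [right|left].
    exists (Num.floor (t0 / eta)); apply/seteqP; split=> t /=.
      by rewrite -t0k => /kE.
    by move=> /kE ->.
  by apply/seteqP; split=> t //= tk; apply: no; exists t.
exists kappa; split=> [k|s t st|k].
- by case: (fiber k) => [->//|[z ->]]; exact: measurable_itv.
- have := (kE t s).1 st; have := (kE t t).1 erefl; rewrite !in_itv /=.
  move=> /andP[h1 h2] /andP[h3 h4]; rewrite ltr_norml; apply/andP; split; lra.
- case: (fiber k) => [->|[z ->]]; first by rewrite measure0 lee_fin ltW.
  rewrite lebesgue_measure_itv /=; case: ifP => _; last by rewrite lee_fin ltW.
  by rewrite -EFinD lee_fin; lra.
Qed.

Variables (p : R) (F : nat -> R -> R) (kappa : R -> nat) (eta : R).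
Hypotheses (p1 : 1 <= p) (mF : forall i, measurable_fun setT (F i)) (eta0 : 0 < eta)
  (mkappa : forall k, measurable (kappa @^-1` [set k]))
  (kappa_le : forall k, (mu (kappa @^-1` [set k]) <= eta%:E)%E)
  (sumF : forall k,
    (\sum_(i <oo) \int[mu]_(t in kappa @^-1` [set k]) (`|F i t| `^ p)%:E < +oo)%E).

Let cell_int i k := (\int[mu]_(t in kappa @^-1` [set k]) (`|F i t| `^ p)%:E)%E.

Let cell_int_ge0 i k : (0 <= cell_int i k)%E.
Proof. by apply: integral_ge0 => t _; rewrite lee_fin powR_ge0. Qed.

(** [q.1] is the index from which functions are replaced by 0 on the cell, [q.2] the mesh to which
    the earlier ones are rounded. Each source of error is kept below [w]. *)
Let cutoff k (w : R) : 0 < w -> exists q : nat * R,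
  [/\ (\sum_(q.1 <= i <oo) cell_int i k <= w%:E)%E, 0 < q.2, q.2 <= 1 &
      q.1%:R * q.2 * eta <= w].
Proof.
move=> w0.
have /fine_cvgP[fin /cvgrPdist_le/(_ w w0) near_w] :=
  @nneseries_tail_cvg R (fun i => cell_int i k) xpredT (sumF k) (fun i _ => cell_int_ge0 i k).
have [n _ /(_ n (leqnn n)) [/=]] := filterI fin near_w.
move=> finn; rewrite sub0r normrN => le.
have d0 : 0 < w + n%:R * eta by rewrite ltr_wpDr// mulr_ge0// ltW.
exists (n, w / (w + n%:R * eta)); split=> /=.
- by rewrite -(fineK finn) lee_fin (le_trans _ le)// ler_norm.
- by rewrite divr_gt0.
- by rewrite ler_pdivrMr// mul1r lerDl mulr_ge0// ltW.
- rewrite mulrA mulrAC ler_pdivrMr// mulrAC mulrC ler_pM2l// lerDr; exact: ltW.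
Qed.

(** On cell [k] the functions of index below [n k] are rounded down to multiples of [dl k], the
    others are replaced by 0. A piece is a cell together with the list of rounded values, coded as
    one number. Rounding costs at most [n k * dl k * eta], as [dl k ^ p <= dl k], and dropping costs
    the tail, so the cell contributes at most [2 * w k]. *)
Lemma discretize (rho : R) : 0 < rho ->
  exists (phi : R -> nat) (M : nat -> nat) (H : nat -> nat -> R),
  [/\ forall q, measurable (phi @^-1` [set q]),
      forall q, (mu (phi @^-1` [set q]) < +oo)%E,
      forall i q, (M q <= i)%N -> H i q = 0 &
      forall n, (\sum_(i < n) Lp_int mu p (fun t => F i t - H i (phi t))%R <= rho%:E)%E].
Proof.
move=> rho0; have p0 : 0 < p by rewrite (lt_le_trans ltr01).
(* Chosen so that the cell errors [2 * w k] add up to [rho]. *)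
pose w k : R := rho / 4 * 2^-1 ^+ k.
have w0 k : 0 < w k by rewrite mulr_gt0 ?divr_gt0// exprn_gt0// invr_gt0.
have [q hq] := choice (fun k => cutoff k (w0 k)).
pose n k := (q k).1; pose dl k := (q k).2.
have tail k : (\sum_(n k <= i <oo) cell_int i k <= (w k)%:E)%E by have [] := hq k.
have dl0 k : 0 < dl k by have [] := hq k.
have dl1 k : dl k <= 1 by have [] := hq k.
have ndl k : (n k)%:R * dl k * eta <= w k by have [] := hq k.
pose levels k (l : seq nat) t := [seq Num.floor (F i t / dl k) | i <- l].
pose phi t := pickle (kappa t, levels (kappa t) (iota 0 (n (kappa t))) t).
pose dec (c : nat) : option (nat * seq int) := unpickle c.
(* A number that codes nothing gets 0 here and in [H]; its piece is empty. *)
pose M c := if dec c is Some ks then n ks.1 else 0%N.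
pose H i c : R := if dec c is Some ks then
  (if (i < n ks.1)%N then dl ks.1 * (nth 0 ks.2 i)%:~R else 0) else 0.
have decphi t : dec (phi t) = Some (kappa t, levels (kappa t) (iota 0 (n (kappa t))) t).
  by rewrite /dec /phi pickleK.
have Hphi i t : H i (phi t) = if (i < n (kappa t))%N then
    dl (kappa t) * (Num.floor (F i t / dl (kappa t)))%:~R else 0.
  rewrite /H decphi /=; case: ifP => // ilt.
  by rewrite (nth_map 0%N) ?size_iota// nth_iota.
have mlevels k l s : measurable [set t | levels k l t = s].
  elim: l s => [|i l IH] [|z s].
  - by rewrite (_ : [set t | _] = setT)//; apply/seteqP; split.
  - by rewrite (_ : [set t | _] = set0)//; apply/seteqP; split.
  - by rewrite (_ : [set t | _] = set0)//; apply/seteqP; split.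
  rewrite (_ : [set t | _] = [set t | Num.floor (F i t / dl k) = z] `&`
      [set t | levels k l t = s]); last first.
    by apply/seteqP; split=> t /= [-> ->].
  apply: measurableI => //; apply: measurable_floor_level.
  by apply: measurable_funM => //; exact: measurable_cst.
have mphi c : measurable (phi @^-1` [set c]).
  have [[t0 <-]|no] := pselect (exists t, phi t = c); last first.
    by rewrite (_ : _ @^-1` _ = set0)//; apply/seteqP; split=> t //= tk; apply: no; exists t.
  rewrite (_ : _ @^-1` _ = kappa @^-1` [set kappa t0] `&`
    [set t | levels (kappa t0) (iota 0 (n (kappa t0))) t =
             levels (kappa t0) (iota 0 (n (kappa t0))) t0]); first exact: measurableI.
  apply/seteqP; split=> t /=.
    by move=> /(congr1 dec); rewrite !decphi => -[<- ->].
  by move=> [kE lE]; rewrite /phi kE lE.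
exists phi, M, H; split=> //.
- move=> c; have [[t0 <-]|no] := pselect (exists t, phi t = c); last first.
    rewrite (_ : _ @^-1` _ = set0) ?measure0 ?ltry//.
    by apply/seteqP; split=> t //= tk; apply: no; exists t.
  apply: (@le_lt_trans _ _ (mu (kappa @^-1` [set kappa t0]))); last first.
    by apply: le_lt_trans (kappa_le _) _; exact: ltry.
  apply: le_measure; [by rewrite inE; exact: mphi|by rewrite inE; exact: mkappa|].
  move=> t; rewrite /preimage /= => e.
  by have := congr1 dec e; rewrite !decphi => -[].
- by move=> i c; rewrite /M /H; case: (dec c) => // ks; rewrite ltnNge => ->.
move=> m.
pose r i t := F i t - H i (phi t).
have mr i : measurable_fun [set: R] (r i).
  by apply: measurable_funB => //; exact: (measurable_fun_fibers (H i) mphi).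
have cover : \bigcup_k kappa @^-1` [set k] = setT.
  by apply/seteqP; split=> t // _; exists (kappa t).
have triv : trivIset setT (fun k => kappa @^-1` [set k]).
  by apply/trivIsetP => i j _ _ ij; apply/seteqP; split=> t //= [ti tj];
    move/eqP: ij; rewrite -ti -tj.
pose ri i k := (\int[mu]_(t in kappa @^-1` [set k]) (`|r i t| `^ p)%:E)%E.
have ri0 i k : (0 <= ri i k)%E by apply: integral_ge0 => t _; rewrite lee_fin powR_ge0.
have split_cells i : (Lp_int mu p (r i) = \sum_(k <oo) ri i k)%E.
  rewrite /Lp_int -{1}cover.
  apply: (@ge0_integral_bigcup _ _ R mu (fun k => kappa @^-1` [set k])
    (fun t => (`|r i t| `^ p)%:E)) => //.
  - by rewrite cover; exact: (measurable_powR_norm p (mr i)).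
under eq_bigr do rewrite split_cells.
rewrite -nneseries_sum//.
have small i k : (i < n k)%N -> (ri i k <= (dl k * eta)%:E)%E.
  move=> ilt; apply: (@le_trans _ _ (\int[mu]_(t in kappa @^-1` [set k]) (dl k)%:E)%E).
    apply: ge0_le_integral => //.
    - exact: mkappa.
    - by apply: measurable_funTS; exact: (measurable_powR_norm p (mr i)).
    move=> t /= tk; rewrite lee_fin.
    have rle : `|r i t| <= dl k.
      rewrite /r Hphi tk ilt.
      have /andP[h1 h2] := floor_itv (F i t / dl k).
      rewrite ler_pdivlMr// mulrC in h1.
      rewrite ltr_pdivrMr// intrD mulrDl mul1r mulrC in h2.
      by rewrite ger0_norm ?subr_ge0// lerBlDl ltW.
    apply: le_trans (powR_le (ltW p0) _ rle) _ => //.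
    by apply: ge1r_powR => //; rewrite dl0 dl1.
  rewrite (integral_cst mu (mkappa k)) EFinM.
  by apply: lee_wpmul2l; [rewrite lee_fin ltW|exact: kappa_le].
have large i k : (n k <= i)%N -> ri i k = cell_int i k.
  move=> nki; apply: eq_integral => t; rewrite inE /= => tk.
  by rewrite /r Hphi tk ltnNge nki subr0.
have cell_le k : (\sum_(i < m) ri i k <= (2 * w k)%:E)%E.
  apply: (@le_trans _ _ (\sum_(0 <= i < maxn m (n k)) ri i k)%E).
    rewrite -(big_mkord xpredT (fun i => ri i k)).
    by apply: lee_sum_nneg_natr => //; exact: leq_maxl.
  rewrite (big_cat_nat (n := n k)) ?leq_maxr//= mulr2n mulrDl mul1r EFinD.
  apply: leeD.
    apply: (@le_trans _ _ (\sum_(0 <= i < n k) (dl k * eta)%:E)%E).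
      by rewrite !big_mkord; apply: lee_sum => i _; exact: small.
    by rewrite big_mkord sumEFin lee_fin sumr_const card_ord -mulr_natl mulrA.
  apply: le_trans (tail k); rewrite (eq_big_nat _ _ (F2 := fun i => cell_int i k)).
    exact: nneseries_lim_ge.
  by move=> i /andP[h _]; exact: large.
apply: (@le_trans _ _ (\sum_(k <oo) (2 * w k)%:E)%E).
  apply: lee_nneseries => [k _ _|k _]; last exact: cell_le.
  by apply: sume_ge0 => i _; exact: ri0.
have cv : series (geometric (rho / 2) 2^-1) @ \oo --> rho.
  have -> : nbhs rho = nbhs (rho / 2 * (1 - 2^-1)^-1) by congr nbhs; field.
  by apply: cvg_geometric_series; rewrite ger0_norm ?invr_ge0// invf_lt1// ltr1n.
rewrite (_ : (\sum_(k <oo) _)%E = rho%:E)//.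
apply/cvg_lim => //; rewrite (_ : (fun k => _) = EFin \o series (geometric (rho / 2) 2^-1)).
  by apply: cvg_EFin => //; exact: nearW.
apply/funext => k; rewrite /= sumEFin; congr (_%:E); apply: eq_bigr => i _.
by rewrite /w /=; field.
Qed.

End Discretization.

(** * Integrated averages over signs *)

Section SeparatedTranslates.
Context {R : realType}.
Local Notation mu := (@lebesgue_measure R).

Lemma sum_translates_cell (p eta : R) (f : R -> R) (lam : nat -> R) (J : set R) :
  measurable_fun setT f -> measurable J ->
  (forall i j, i != j -> eta <= `|lam i - lam j|) ->
  (forall s t, J s -> J t -> `|s - t| < eta) ->
  (\sum_(i <oo) \int[mu]_(t in J) (`|translate f (lam i) t| `^ p)%:E <= Lp_int mu p f)%E.
Proof.
move=> mf mJ sep small.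
pose g t := (`|f t| `^ p)%:E.
have mg : measurable_fun [set: R] g by exact: measurable_powR_norm.
have g0 t : (0 <= g t)%E by rewrite lee_fin powR_ge0.
pose S i := [set s | J (s + lam i)].
have mS i : measurable (S i).
  rewrite -[X in measurable X]setTI.
  have mpsi : measurable_fun [set: R] ((fun x => x + lam i) : R -> R).
    by apply: measurable_funD => //; exact: measurable_cst.
  exact: mpsi.
have triv : trivIset setT S.
  apply/trivIsetP => i j _ _ ij; apply/seteqP; split=> s //= [si sj].
  have := sep i j ij; have := small _ _ si sj.
  have -> : s + lam i - (s + lam j) = lam i - lam j by ring.
  by move=> /lt_le_trans h /h; rewrite ltxx.
rewrite (eq_eseriesr (g := fun i => \int[mu]_(t in S i) g t)%E); last first.
  by move=> i _; exact: ge0_integral_shift.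
have mU : measurable (\bigcup_i S i) by exact: bigcupT_measurable.
rewrite -(ge0_integral_bigcup mu mS (measurable_funTS mg) (fun t _ => g0 t) triv).
exact: ge0_subset_integral.
Qed.

End SeparatedTranslates.

Section SignIntegrals.
Context {d} {T : measurableType d} {R : realType}.
Variables (mu : {measure set T -> \bar R}) (p : R).
Hypothesis p0 : 0 < p.
Implicit Types (g h : nat -> T -> R) (a : nat -> R).

Definition sign_int n g a : \bar R :=
  (\int[mu]_t (sign_avg n (fun s => `|s| `^ p) (fun i => a i * g i t))%:E)%E.

Lemma measurable_sign_sum n g a j : (forall i, measurable_fun setT (g i)) ->
  measurable_fun setT (fun t => sign_sum n (fun i => a i * g i t) j).
Proof.
move=> mg; apply: measurable_sum => i; apply: measurable_funM; first exact: measurable_cst.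
by apply: measurable_funM => //; exact: measurable_cst.
Qed.

Lemma measurable_sign_avg n g a : (forall i, measurable_fun setT (g i)) ->
  measurable_fun [set: T]
    (EFin \o (fun t => sign_avg n (fun s => `|s| `^ p) (fun i => a i * g i t))).
Proof.
move=> mg; apply/measurable_EFinP; apply: measurable_funM; first exact: measurable_cst.
apply: measurable_sum => j; apply/measurable_EFinP.
exact: (measurable_powR_norm p (measurable_sign_sum n a j mg)).
Qed.

Lemma sign_int_ge0 n g a : (0 <= sign_int n g a)%E.
Proof. by apply: integral_ge0 => t _; rewrite lee_fin sign_avg_powR_ge0. Qed.

(** Integrating before averaging exhibits the [p]-th powers of the norms of the signed sums, to
    which the unconditional constant applies. *)
Lemma sign_intE n g a : (forall i, measurable_fun setT (g i)) ->
  (sign_int n g a = (2^-1 ^+ n)%:E *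
    \sum_(j < 2 ^ n) Lp_int mu p (fun t => sign_sum n (fun i => a i * g i t)%R j))%E.
Proof.
move=> mg; have mj j := measurable_powR_norm p (measurable_sign_sum n a j mg).
have nn (f : T -> R) t : [set: T] t -> (0 <= (`|f t| `^ p)%:E)%E.
  by rewrite lee_fin powR_ge0.
rewrite /Lp_int -(ge0_integral_sum mu measurableT
  (fun j : 'I_(2 ^ n) => mj j) (fun j : 'I_(2 ^ n) => @nn _)).
have k0 : 0 <= 2^-1 ^+ n :> R by rewrite exprn_ge0// invr_ge0.
have sum0 t : [set: T] t -> (0 <= \sum_(j < 2 ^ n)
    (`|sign_sum n (fun i => a i * g i t)%R j| `^ p)%:E)%E.
  by move=> _; apply: sume_ge0 => j _; rewrite lee_fin powR_ge0.
rewrite -(ge0_integralZl_EFin mu measurableT sum0 _ k0).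
  by apply: eq_integral => t _; rewrite /sign_avg EFinM sumEFin.
by apply: emeasurable_sum => j; exact: mj.
Qed.

Lemma sign_int_bounds n g a (c : R) : (forall i, measurable_fun setT (g i)) ->
  ((forall j, Lp_int mu p (fun t => sign_sum n (fun i => a i * g i t)%R j) <= c%:E) ->
     sign_int n g a <= c%:E)%E /\
  ((forall j, c%:E <= Lp_int mu p (fun t => sign_sum n (fun i => a i * g i t)%R j)) ->
     c%:E <= sign_int n g a)%E.
Proof.
move=> mg; have k0 : (0 <= (2^-1 ^+ n)%:E :> \bar R)%E.
  by rewrite lee_fin exprn_ge0// invr_ge0.
have cE : c%:E = ((2^-1 ^+ n)%:E * \sum_(j < 2 ^ n) c%:E)%E.
  by rewrite sumEFin -EFinM; congr (_%:E); exact/esym/(sign_avg_cst n c (fun=> 0)).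
rewrite (sign_intE n a mg); split=> H; rewrite cE; apply: lee_wpmul2l => //;
  by apply: lee_sum => j _; exact: H.
Qed.

Lemma sign_int_cotype n g a : 2 <= p -> (forall i, measurable_fun setT (g i)) ->
  (\sum_(i < n) (`|a i| `^ p)%:E * Lp_int mu p (g i) <= sign_int n g a)%E.
Proof.
move=> p2 mg.
have nn (i : nat) t : [set: T] t -> (0 <= (`|a i| `^ p * `|g i t| `^ p)%:E)%E.
  by rewrite lee_fin mulr_ge0// powR_ge0.
have mm (i : nat) : measurable_fun [set: T]
    (EFin \o (fun t => `|a i| `^ p * `|g i t| `^ p)).
  apply/measurable_EFinP; apply: measurable_funM; first exact: measurable_cst.
  by apply/measurable_EFinP; exact: (measurable_powR_norm p (mg i)).
under eq_bigr => i _ do rewrite -(Lp_int_scale mu p (powR_ge0 _ _) (mg i)).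
rewrite -(ge0_integral_sum mu measurableT (fun i : 'I_n => mm i) (fun i : 'I_n => @nn i)).
apply: ge0_le_integral => //.
- by move=> t _; apply: sume_ge0 => i _; exact: (nn _ t I).
- by apply: emeasurable_sum => i; exact: mm.
- exact: measurable_sign_avg.
move=> t _; rewrite sumEFin lee_fin; apply: le_trans (sign_avg_cotype _ _ p2).
by apply: ler_sum => i _; rewrite normrM powRM.
Qed.

Lemma sign_int_type n g a : p <= 4 -> (forall i, measurable_fun setT (g i)) ->
  (sign_int n g a <= (4 * \sum_(i < n) `|a i| `^ p)%:E * \sum_(i < n) Lp_int mu p (g i))%E.
Proof.
move=> p4 mg.
have nn (i : nat) t : [set: T] t -> (0 <= (`|g i t| `^ p)%:E)%E.
  by rewrite lee_fin powR_ge0.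
have mm i := measurable_powR_norm p (mg i).
have c0 : 0 <= 4 * \sum_(i < n) `|a i| `^ p.
  by rewrite mulr_ge0//; apply: sumr_ge0 => i _; exact: powR_ge0.
have sum0 t : [set: T] t -> (0 <= \sum_(i < n) (`|g i t| `^ p)%:E)%E.
  by move=> _; apply: sume_ge0 => i _; exact: (nn _ t I).
have msum : measurable_fun setT (fun t => \sum_(i < n) (`|g i t| `^ p)%:E)%E.
  by apply: emeasurable_sum => i; exact: mm.
rewrite /Lp_int -(ge0_integral_sum mu measurableT (fun i : 'I_n => mm i)
  (fun i : 'I_n => @nn i)) -(ge0_integralZl_EFin mu measurableT sum0 msum c0).
apply: ge0_le_integral => //.
- by move=> t _; rewrite lee_fin sign_avg_powR_ge0.
- exact: measurable_sign_avg.
- by apply: measurable_funeM.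
by move=> t _; rewrite sumEFin -EFinM lee_fin; exact: sign_avg_powRM_le.
Qed.

Lemma sign_intD n g h a : (forall i, measurable_fun setT (g i)) ->
  (forall i, measurable_fun setT (h i)) ->
  (sign_int n (fun i t => g i t + h i t)%R a <=
   (2 `^ p)%:E * (sign_int n g a + sign_int n h a))%E.
Proof.
move=> mg mh.
have nn f t : [set: T] t ->
    (0 <= (sign_avg n (fun s => `|s| `^ p) (fun i => a i * f i t))%:E)%E.
  by rewrite lee_fin sign_avg_powR_ge0.
have mG := measurable_sign_avg n a mg; have mH := measurable_sign_avg n a mh.
rewrite /sign_int -(ge0_integralD mu measurableT (nn g) mG (nn h) mH).
have nnD t : [set: T] t -> (0 <= (sign_avg n (fun s => `|s| `^ p) (fun i => a i * g i t))%:E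
   + (sign_avg n (fun s => `|s| `^ p) (fun i => a i * h i t))%:E)%E.
  by move=> tT; rewrite adde_ge0// nn.
rewrite -(ge0_integralZl_EFin mu measurableT nnD (emeasurable_funD mG mH) (powR_ge0 2 p)).
apply: ge0_le_integral => //.
- exact: nn.
- by apply: measurable_sign_avg => i; exact: measurable_funD.
- by apply: measurable_funeM; exact: emeasurable_funD.
move=> t _; rewrite -EFinD -EFinM lee_fin.
rewrite (@eq_sign_avg _ _ _ _ (fun i => a i * g i t + a i * h i t)).
  by apply: sign_avg_powRD; exact: ltW.
by move=> i _; rewrite mulrDr.
Qed.

Lemma sign_int_homo g a : 2 <= p -> (forall i, measurable_fun setT (g i)) ->
  forall m n, (m <= n)%N -> (sign_int m g a <= sign_int n g a)%E.
Proof.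
move=> p2 mg m n mn; apply: ge0_le_integral => //.
- by move=> t _; rewrite lee_fin sign_avg_powR_ge0.
- exact: measurable_sign_avg.
- exact: measurable_sign_avg.
by move=> t _; rewrite lee_fin; exact: sign_avg_homo.
Qed.

(** At each point the averages increase with [n] and are constant from [m t] on, so monotone
    convergence identifies [Q] as the supremum of the integrals. *)
Lemma sign_int_lim g a (m : T -> nat) : 2 <= p -> (forall i, measurable_fun setT (g i)) ->
  (forall i t, (m t <= i)%N -> g i t = 0) ->
  let Q := (\int[mu]_t
    (sign_avg (m t) (fun s => `|s| `^ p) (fun i => a i * g i t))%:E)%E in
  (forall n, (sign_int n g a <= Q)%E) /\
  (forall c, (forall n, (sign_int n g a <= c)%E) -> (Q <= c)%E).
Proof.
move=> p2 mg gm Q.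
have cvQ : sign_int n g a @[n --> \oo] --> Q.
  rewrite /Q (_ : (fun t => _) = (fun t => limn (fun n =>
      (sign_avg n (fun s => `|s| `^ p) (fun i => a i * g i t))%:E))); last first.
    apply/funext => t; apply/esym/cvg_lim => //; apply: cvg_near_cst.
    near=> n; congr (_%:E); apply: sign_avg_stable; last by near: n; exact: nbhs_infty_ge.
    by move=> i /gm ->; rewrite mulr0.
  apply: cvg_monotone_convergence => //.
  - by move=> n; exact: measurable_sign_avg.
  - by move=> n t _; rewrite lee_fin sign_avg_powR_ge0.
  - by move=> t _ n n' nn'; rewrite lee_fin; exact: sign_avg_homo.
split=> [n|c Hc].
  rewrite -(cvg_lim _ cvQ)//; apply: lime_ge; first exact: cvgP cvQ.
  by near=> k; apply: sign_int_homo => //; near: k; exact: nbhs_infty_ge.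
rewrite -(cvg_lim _ cvQ)//; apply: lime_le; first exact: cvgP cvQ.
exact: nearW.
Unshelve. all: by end_near. Qed.

Lemma nneseries_pairs (e : nat -> nat * nat) (u : nat -> nat -> \bar R) :
  set_bij setT setT e -> (forall i j, 0 <= u i j)%E ->
  (\sum_(k <oo) u (e k).1 (e k).2 = \sum_(i <oo) \sum_(j <oo) u i j)%E.
Proof.
move=> be u0; rewrite nneseries_esumT//.
rewrite -(reindex_esum setT setT e (fun x => u x.1 x.2) be).
rewrite [RHS]nneseries_esumT; last by move=> i; exact: nneseries_ge0.
under [RHS]eq_esum => i _ do rewrite nneseries_esumT//.
rewrite (@esum_esum _ _ _ setT (fun=> setT) u)//.
by congr esum; apply/seteqP; split.
Qed.

(** There is one entry for each piece [q] and each choice of signs [j < 2 ^ M q], and zeros for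
    larger [j]; a bijection between [nat] and pairs turns this into a sequence. *)
Lemma lp_encoding (phi : T -> nat) (M : nat -> nat) (H : nat -> nat -> R) :
  (forall q, measurable (phi @^-1` [set q])) ->
  (forall q, (mu (phi @^-1` [set q]) < +oo)%E) ->
  exists L : (nat -> R) -> nat -> R,
  (forall x y a b k, L (fun i => x * a i + y * b i) k = x * L a k + y * L b k) /\
  (forall a, (\sum_(k <oo) (`|L a k| `^ p)%:E = \int[mu]_t
    (sign_avg (M (phi t)) (fun s => `|s| `^ p) (fun i => a i * H i (phi t)))%:E)%E).
Proof.
move=> mphi fphi.
have [e be] : exists e : nat -> nat * nat, set_bij setT setT e.
  by have /card_esym/card_set_bijP[e] := card_nat2; exists e.
pose c q := fine (mu (phi @^-1` [set q])).
have cE q : mu (phi @^-1` [set q]) = (c q)%:E by rewrite fineK// ge0_fin_numE.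
have c0 q : 0 <= c q by exact: fine_ge0.
(* Measure of the piece times the probability of one choice of signs; its [p]-th root scales the
   entry. *)
pose w q := c q * 2^-1 ^+ M q.
have w0 q : 0 <= w q by rewrite mulr_ge0// exprn_ge0// invr_ge0.
pose tm a q j := if (j < 2 ^ M q)%N then
  w q `^ p^-1 * sign_sum (M q) (fun i => a i * H i q) j else 0.
have tmE a q j : `|tm a q j| `^ p = if (j < 2 ^ M q)%N then
    w q * `|sign_sum (M q) (fun i => a i * H i q) j| `^ p else 0.
  rewrite /tm; case: ifP => _; last by rewrite normr0 powR0// gt_eqF.
  by rewrite normrM powRM// (ger0_norm (powR_ge0 _ _)) powRVK// gt_eqF.
exists (fun a k => tm a (e k).1 (e k).2); split.
  move=> x y a b k; rewrite /tm; case: ifP => _; last by rewrite !mulr0 addr0.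
  rewrite (@eq_sign_sum _ _ _ (fun i => x * (a i * H i (e k).1) + y * (b i * H i (e k).1))).
    by rewrite sign_sumD !sign_sumZ; ring.
  by move=> i _; ring.
move=> a; rewrite (nneseries_pairs be (u := fun q j => (`|tm a q j| `^ p)%:E)); last first.
  by move=> q j; rewrite lee_fin powR_ge0.
pose G q := sign_avg (M q) (fun s => `|s| `^ p) (fun i => a i * H i q).
have G0 q : 0 <= G q by exact: sign_avg_powR_ge0.
have mG : measurable_fun [set: T] (fun t => (G (phi t))%:E).
  by apply/measurable_EFinP; exact: (measurable_fun_fibers G mphi).
have cover : \bigcup_q phi @^-1` [set q] = setT.
  by apply/seteqP; split=> t // _; exists (phi t).
have triv : trivIset setT (fun q => phi @^-1` [set q]).
  by apply/trivIsetP => i j _ _ ij; apply/seteqP; split=> t //= [ti tj];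
    move/eqP: ij; rewrite -ti -tj.
have -> : (\int[mu]_t (G (phi t))%:E =
    \sum_(q <oo) \int[mu]_(t in phi @^-1` [set q]) (G (phi t))%:E)%E.
  rewrite -{1}cover; apply: (@ge0_integral_bigcup _ _ R mu
    (fun q => phi @^-1` [set q]) (fun t => (G (phi t))%:E)) => //.
  - by rewrite cover.
  - by move=> t _; rewrite lee_fin.
apply: eq_eseriesr => q _.
rewrite (eq_integral (cst (G q)%:E)); last by move=> t; rewrite inE /= => ->.
rewrite (integral_cst mu (mphi q)) cE -EFinM.
rewrite (nneseries_split 0 (2 ^ M q)); last first.
  by move=> j _; rewrite lee_fin powR_ge0.
rewrite add0n [X in (_ + X)%E]eseries0 ?adde0; last first.
  by move=> j jM _; rewrite tmE ltnNge jM.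
rewrite big_mkord (eq_bigr (fun j : 'I_(2 ^ M q) =>
  (w q * `|sign_sum (M q) (fun i => a i * H i q) j| `^ p)%:E)); last first.
  by move=> j _; rewrite tmE ltn_ord.
by rewrite sumEFin -mulr_sumr /w /G /sign_avg; congr (_%:E); ring.
Qed.

End SignIntegrals.

(** * The unconditional constant in L_p *)

Section UnconditionalBasisLp.
Context {R : realType}.
Variables (p : R) (X : set (R -> R)) (b : nat -> R -> R).
Hypotheses (p1 : 1 <= p) (clX : closed_subspace p X) (basX : unconditional_basis p b X).
Local Notation mu := (@lebesgue_measure R).
(** The same functions with their pointwise module structure, as the abstract argument requires. *)
Let V : lmodType R := R -> R^o.

Let Lp_conv_seminorm (u : nat -> V) (x : V) :
  seminorm_cvg (Lp_norm p : V -> R) u x <-> Lp_conv p u x.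
Proof.
rewrite /Lp_conv /seminorm_cvg; split=> [H|/cvgrPdist_le H e e0].
  apply/cvgrPdist_le => e e0; have [n0 hn0] := H e e0.
  exists n0 => // n /= /hn0; rewrite sub0r normrN ger0_norm//; exact: norm_p_ge0.
have [n0 _ hn0] := H e e0; exists n0 => n /hn0.
by rewrite /= sub0r normrN ger0_norm//; exact: norm_p_ge0.
Qed.

Let expansionE (a : nat -> R) (s : nat -> nat) n :
  (\sum_(i < n) a (s i) *: (b (s i) : V)) = psum a b s n.
Proof. by apply/funext => t; rewrite /psum fct_sumE. Qed.

Let expansion_psum (a : nat -> R) : expansion (b : nat -> V) a = psum a b id.
Proof. by apply/funext => n; exact: (expansionE a id n). Qed.

Let X0 : X (0 : V). Proof. by case: clX. Qed.

Let Xlin (c : R) (x y : V) : X x -> X y -> X (c *: x + y).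
Proof.
move=> Xx Xy; case: clX => _ _ /(_ c 1 x y Xx Xy) + _.
by under eq_fun do rewrite mul1r.
Qed.

Let XL (x : V) : X x -> in_Lp mu p x. Proof. by case: clX => + _ _ _; apply. Qed.

Let NZ (c : R) (x : V) : X x -> Lp_norm p (c *: x) = `|c| * Lp_norm p x.
Proof. by move=> /XL; exact: norm_pZ. Qed.

Let ND (x y : V) : X x -> X y -> Lp_norm p (x + y) <= Lp_norm p x + Lp_norm p y.
Proof. by move=> /XL Lx /XL Ly; exact: norm_pD. Qed.

Let Xb i : X (b i : V). Proof. by case: basX. Qed.

Let Xcomplete (u : nat -> V) : (forall n, X (u n)) ->
  (forall n, Lp_norm p (u n.+1 - u n) <= 4^-1 ^+ n) ->
  exists2 x, X x & seminorm_cvg (Lp_norm p : V -> R) u x.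
Proof.
move=> Xu hu; have [x Lx ux] := @Lp_complete _ _ R mu p p1 u (fun n => XL (Xu n)) hu.
have cvu : Lp_conv p u x.
  have cv : (2 * 4^-1 ^+ n) @[n --> \oo] --> (0 : R).
    by apply: cvg_geometric; rewrite ger0_norm ?invr_ge0// invf_lt1// ltr1n.
  apply/cvgrPdist_le => e e0; have /cvgrPdist_le/(_ e e0) := cv.
  apply: filterS => n; rewrite !sub0r !normrN => le.
  rewrite ger0_norm; last exact: norm_p_ge0.
  by apply: le_trans (ux n) _; apply: le_trans le; rewrite ler_norm.
exists x; last exact/Lp_conv_seminorm.
by case: clX => _ _ _ cl; exact: (cl u x Xu Lx cvu).
Qed.

Let Xexp (x : V) : X x -> exists a, seminorm_cvg (Lp_norm p : V -> R) (expansion b a) x.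
Proof.
case: basX => _ /(_ x) + Xx => /(_ Xx) [[a [ax _]] _].
by exists a; rewrite expansion_psum; exact/Lp_conv_seminorm.
Qed.

Let Xuniq (x : V) (a a' : nat -> R) : X x ->
  seminorm_cvg (Lp_norm p : V -> R) (expansion b a) x ->
  seminorm_cvg (Lp_norm p : V -> R) (expansion b a') x -> forall i, a i = a' i.
Proof.
case: basX => _ /(_ x) + Xx => /(_ Xx) [[c [_ uc]] _].
rewrite !expansion_psum => /Lp_conv_seminorm ax /Lp_conv_seminorm ax' i.
by rewrite -(uc _ ax) -(uc _ ax').
Qed.

Let Xperm (x : V) (a : nat -> R) (s : nat -> nat) : X x ->
  seminorm_cvg (Lp_norm p : V -> R) (expansion b a) x -> bijective s ->
  seminorm_cvg (Lp_norm p : V -> R) (fun n => \sum_(i < n) a (s i) *: (b (s i) : V)) x.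
Proof.
case: basX => _ /(_ x) + Xx => /(_ Xx) [_ perm].
rewrite expansion_psum => /Lp_conv_seminorm ax bs.
rewrite (_ : (fun n => _) = psum a b s); first exact/Lp_conv_seminorm/perm.
by apply/funext => n; exact: expansionE.
Qed.

Lemma basis_Lp_norm_gt0 i : 0 < Lp_norm p (b i).
Proof. exact: (@basis_gt0 R V X _ _ X0 Xlin (fun x _ => norm_p_ge0 mu p x) NZ ND Xb Xuniq). Qed.

Lemma unconditional_constant_Lp : exists2 C : R, 0 < C &
  forall x a n (e : nat -> bool), X x ->
  Lp_conv p (psum a b id) x ->
  Lp_norm p (fun t => \sum_(i < n) (-1) ^+ e i * a i * b i t) <= C * Lp_norm p x.
Proof.
have [C C0 HC] := @unconditional_constant R V X _ _ X0 Xlin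
  (fun x _ => norm_p_ge0 mu p x) NZ ND Xb Xcomplete Xexp Xuniq Xperm.
exists C => // x a n e Xx ax.
have := HC x a n e Xx; rewrite expansion_psum.
rewrite /signed_expansion (_ : \sum_(i < n) _ = (fun t => \sum_(i < n) (-1) ^+ e i * a i * b i t)).
  by apply; exact/Lp_conv_seminorm.
by apply/funext => t; rewrite fct_sumE.
Qed.

End UnconditionalBasisLp.

(** * Expansions with respect to an unconditional basis *)

Section Expansions.
Context {R : realType}.
Variables (p : R) (X : set (R -> R)) (b : nat -> R -> R).
Hypotheses (p1 : 1 <= p) (clX : closed_subspace p X) (basX : unconditional_basis p b X).
Local Notation mu := (@lebesgue_measure R).

Let p0 : 0 < p. Proof. exact: lt_le_trans p1. Qed.

Let XL x : X x -> in_Lp mu p x. Proof. by case: clX => + _ _ _; apply. Qed.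

Let Xb i : X (b i). Proof. by case: basX. Qed.

Let Lb i : in_Lp mu p (b i). Proof. exact/XL/Xb. Qed.

Lemma psumS (a : nat -> R) n :
  psum a b id n.+1 = (fun t => 1 * psum a b id n t + a n * b n t).
Proof. by apply/funext => t; rewrite /psum big_ord_recr /= mul1r. Qed.

Lemma psum_in_subspace (a : nat -> R) n : X (psum a b id n).
Proof.
case: clX => _ X0 Xlin _; elim: n => [|n IH]; last by rewrite psumS; exact: Xlin.
by rewrite (_ : psum _ _ _ _ = fun=> 0)//; apply/funext => t; rewrite /psum big_ord0.
Qed.

Lemma Lp_conv_finite (a : nat -> R) n : (forall i, (n <= i)%N -> a i = 0) ->
  Lp_conv p (psum a b id) (psum a b id n).
Proof.
move=> a0; apply: cvg_near_cst; near=> m.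
have nm : (n <= m)%N by near: m; exact: nbhs_infty_ge.
have -> : psum a b id m = psum a b id n.
  rewrite -(subnKC nm); elim: (m - n)%N => [|k IH]; first by rewrite addn0.
  rewrite addnS psumS IH; apply/funext => t.
  by rewrite a0 ?leq_addr// mul0r addr0 mul1r.
rewrite (_ : (fun t => _) = (fun t => 0 * b 0%N t)); last first.
  by apply/funext => t; rewrite subrr mul0r.
by have := norm_pZ p1 0 (Lb 0); rewrite normr0 mul0r.
Unshelve. all: by end_near. Qed.

Lemma Lp_conv_lin (x y : R -> R) (a a' : nat -> R) (c c' : R) : X x -> X y ->
  Lp_conv p (psum a b id) x -> Lp_conv p (psum a' b id) y ->
  Lp_conv p (psum (fun i => c * a i + c' * a' i) b id) (fun t => c * x t + c' * y t).
Proof.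
move=> Xx Xy ax ay; rewrite /Lp_conv.
have Ld (z : R -> R) (u : nat -> R) n : X z -> in_Lp mu p (fun t => psum u b id n t - z t).
  by move=> Xz; apply: in_LpB => //; [exact/XL/psum_in_subspace|exact: XL].
apply: (@squeeze_cvgr _ _ _ _ (fun=> 0) (fun n =>
   `|c| * Lp_norm p (fun t => psum a b id n t - x t) +
   `|c'| * Lp_norm p (fun t => psum a' b id n t - y t))).
- apply: nearW => n; apply/andP; split; first exact: norm_p_ge0.
  rewrite (_ : (fun t => _) = (fun t => c * (psum a b id n t - x t) +
      c' * (psum a' b id n t - y t))); last first.
    apply/funext => t; rewrite /psum !mulrBr !mulr_sumr opprD addrACA; congr (_ + _).
    by rewrite -big_split; apply: eq_bigr => i _ /=; ring.
  apply: le_trans (norm_pD p1 (in_LpZ p1 c (Ld _ _ _ Xx)) (in_LpZ p1 c' (Ld _ _ _ Xy))) _.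
  by rewrite (norm_pZ p1 c (Ld _ _ _ Xx)) (norm_pZ p1 c' (Ld _ _ _ Xy)).
- exact: cvg_cst.
- have -> : nbhs (0 : R) = nbhs (`|c| * 0 + `|c'| * 0) by rewrite !mulr0 addr0.
  by apply: cvgD; apply: cvgM => //; exact: cvg_cst.
Qed.

Variable C : R.
Hypotheses (C0 : 0 < C) (HC : forall x a n (e : nat -> bool), X x ->
  Lp_conv p (psum a b id) x ->
  Lp_norm p (fun t => \sum_(i < n) (-1) ^+ e i * a i * b i t) <= C * Lp_norm p x).

(** Signs are involutive: the unsigned sum is obtained by applying [e] to the signed one, which is
    itself an element of [X] with a finite expansion. *)
Lemma psum_norm_le_signed (a : nat -> R) n (e : nat -> bool) :
  Lp_norm p (psum a b id n) <=
  C * Lp_norm p (fun t => \sum_(i < n) (-1) ^+ e i * (a i * b i t)).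
Proof.
pose a' i := if (i < n)%N then (-1) ^+ e i * a i else 0.
have -> : (fun t => \sum_(i < n) (-1) ^+ e i * (a i * b i t)) = psum a' b id n.
  by apply/funext => t; apply: eq_bigr => i _; rewrite /a' ltn_ord mulrA.
have -> : psum a b id n = (fun t => \sum_(i < n) (-1) ^+ e i * a' i * b i t).
  apply/funext => t; apply: eq_bigr => i _; rewrite /a' ltn_ord mulrA.
  by rewrite -signr_addb addbb expr0 mul1r.
apply: HC; first exact: psum_in_subspace.
by apply: Lp_conv_finite => i ni; rewrite /a' ltnNge ni.
Qed.

Let in_Lp_sign_sum (a : nat -> R) n j :
  in_Lp mu p (fun t => sign_sum n (fun i => a i * b i t) j).
Proof.
pose a' i := (-1) ^+ odd (j %/ 2 ^ i) * a i.
rewrite (_ : (fun t => _) = psum a' b id n); first exact/XL/psum_in_subspace.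
by apply/funext => t; apply: eq_bigr => i _; rewrite /a' mulrA.
Qed.

(** Every choice of signs has norm at least that of the unsigned sum divided by [C], and so has the
    average. *)
Lemma psum_norm_le_sign_int (a : nat -> R) n :
  ((Lp_norm p (psum a b id n) `^ p)%:E <= (C `^ p)%:E * sign_int mu p n b a)%E.
Proof.
have mb i : measurable_fun setT (b i) by exact: (Lb i).1.
have [_ H] := @sign_int_bounds _ _ _ mu p n b a ((Lp_norm p (psum a b id n) / C) `^ p) mb.
have N0 : 0 <= Lp_norm p (psum a b id n) by exact: norm_p_ge0.
rewrite (_ : Lp_norm p (psum a b id n) `^ p = C `^ p * (Lp_norm p (psum a b id n) / C) `^ p).
  rewrite EFinM; apply: lee_wpmul2l; first by rewrite lee_fin powR_ge0.
  apply: H => j; rewrite (in_Lp_int p1 (in_Lp_sign_sum a n j)) lee_fin.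
  apply: powR_le; [exact: ltW|by rewrite divr_ge0// ltW|].
  rewrite ler_pdivrMr// mulrC.
  exact: (psum_norm_le_signed a n (fun i => odd (j %/ 2 ^ i))).
by rewrite -powRM ?divr_ge0 ?(ltW C0)//; congr (_ `^ _); field; rewrite gt_eqF.
Qed.

Lemma sign_int_le_norm (x : R -> R) (a : nat -> R) n : X x ->
  Lp_conv p (psum a b id) x ->
  (sign_int mu p n b a <= ((C * Lp_norm p x) `^ p)%:E)%E.
Proof.
move=> Xx ax; have mb i : measurable_fun setT (b i) by exact: (Lb i).1.
have [H _] := @sign_int_bounds _ _ _ mu p n b a ((C * Lp_norm p x) `^ p) mb.
apply: H => j; rewrite (in_Lp_int p1 (in_Lp_sign_sum a n j)) lee_fin.
apply: powR_le; [exact: ltW|exact: norm_p_ge0|].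
rewrite (_ : (fun t => _) =
  (fun t => \sum_(i < n) (-1) ^+ odd (j %/ 2 ^ i) * a i * b i t)).
  exact: (HC n (fun i => odd (j %/ 2 ^ i)) Xx ax).
by apply/funext => t; apply: eq_bigr => i _; rewrite mulrA.
Qed.

End Expansions.

(** * Stability of the averages under perturbation *)

Section Comparison.
Context {d} {T : measurableType d} {R : realType}.
Variables (mu : {measure set T -> \bar R}) (p N rho : R) (b h : nat -> T -> R).
Hypotheses (p2 : 2 <= p) (p4 : p <= 4)
  (mb : forall i, measurable_fun setT (b i)) (mh : forall i, measurable_fun setT (h i))
  (bN : forall i, Lp_int mu p (b i) = N%:E)
  (hrho : forall n, (\sum_(i < n) Lp_int mu p (fun t => b i t - h i t)%R <= rho%:E)%E)
  (rho_small : 2 `^ p * (4 * rho) <= N / 2).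

Let absorb_half (q : R) (x y : \bar R) : (x \is a fin_num)%E -> (0 <= x)%E ->
  (0 <= y)%E -> 1 <= q ->
  (x <= q%:E * y + (fine x / 2)%:E)%E -> (y <= q%:E * x + (fine x / 2)%:E)%E ->
  (x <= (2 * q)%:E * y)%E /\ (y <= (2 * q)%:E * x)%E.
Proof.
case: x => [r| |]// _; case: y => [s| |]//.
by rewrite /= -!EFinM -!EFinD !lee_fin => r0 s0 q1 h1 h2; split; nra.
Qed.

(** The perturbation [b i - h i] contributes at most half of the average of
    the signed sums of the [b i], by the cotype inequality. *)
Lemma sign_int_perturb n (a : nat -> R) : sign_int mu p n b a \is a fin_num ->
  (sign_int mu p n b a <= (2 * 2 `^ p)%:E * sign_int mu p n h a)%E /\
  (sign_int mu p n h a <= (2 * 2 `^ p)%:E * sign_int mu p n b a)%E.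
Proof.
move=> fin; have p0 : 0 < p by rewrite (lt_le_trans _ p2).
set A := sign_int mu p n b a in fin *; set H := sign_int mu p n h a.
have H0 : (0 <= H)%E by exact: sign_int_ge0.
pose S := \sum_(i < n) `|a i| `^ p.
have S0 : 0 <= S by apply: sumr_ge0 => i _; exact: powR_ge0.
have SA : S * N <= fine A.
  rewrite -lee_fin (fineK fin); have := @sign_int_cotype _ _ _ mu p n b a p2 mb.
  by under eq_bigr do rewrite bN -EFinM; rewrite sumEFin -mulr_suml.
(* The chain is [2 ^ p * 4 * S * rho <= S * N / 2 <= A / 2]. It is stated for general [g] to serve
   both [b - h] and [h - b], one for each direction of the comparison. *)
have err (g : nat -> T -> R) : (forall i, measurable_fun setT (g i)) ->
    (\sum_(i < n) Lp_int mu p (g i) <= rho%:E)%E ->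
    ((2 `^ p)%:E * sign_int mu p n g a <= (fine A / 2)%:E)%E.
  move=> mg grho.
  have c0 : 0 <= 4 * S by rewrite mulr_ge0.
  apply: (@le_trans _ _ ((2 `^ p)%:E * ((4 * S)%:E * rho%:E))%E).
    apply: lee_wpmul2l; first by rewrite lee_fin powR_ge0.
    apply: le_trans (@sign_int_type _ _ _ mu p p0 n g a p4 mg) _.
    by apply: lee_wpmul2l => //; rewrite lee_fin.
  rewrite -!EFinM lee_fin; have := ler_wpM2l S0 rho_small; move: SA.
  set q := 2 `^ p; nra.
have errbh := err (fun i t => b i t - h i t)
  (fun i => measurable_funB (mb i) (mh i)) (hrho n).
have errhb : ((2 `^ p)%:E * sign_int mu p n (fun i t => h i t - b i t)%R a
    <= (fine A / 2)%:E)%E.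
  apply: err => [i|]; first exact: measurable_funB.
  rewrite (eq_bigr (fun i : 'I_n => Lp_int mu p (fun t => b i t - h i t)%R)) => [|i _].
    exact: hrho.
  by apply: eq_integral => t _; rewrite distrC.
have q1 : 1 <= 2 `^ p.
  by apply: le_trans (le1r_powR _ _); rewrite ?ler1n// (le_trans _ p2)// ler1n.
have q0 : 0 <= 2 `^ p by exact: powR_ge0.
have mbh i := measurable_funB (mb i) (mh i).
have mhb i := measurable_funB (mh i) (mb i).
have D1 := @sign_intD _ _ _ mu p p0 n h (fun i t => b i t - h i t) a mh mbh.
have D2 := @sign_intD _ _ _ mu p p0 n b (fun i t => h i t - b i t) a mb mhb.
rewrite (_ : (fun i t => h i t + (b i t - h i t)) = b) -/A -/H in D1; last first.
  by apply/funext => i; apply/funext => t; rewrite addrC subrK.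
rewrite (_ : (fun i t => b i t + (h i t - b i t)) = h) -/A -/H in D2; last first.
  by apply/funext => i; apply/funext => t; rewrite addrC subrK.
rewrite ge0_muleDr ?sign_int_ge0// in D1.
rewrite ge0_muleDr ?sign_int_ge0// in D2.
have {}D1 := le_trans D1 (leeD2l _ errbh).
have {}D2 := le_trans D2 (leeD2l _ errhb).
exact: (absorb_half fin (sign_int_ge0 mu p n b a) H0 q1 D1 D2).
Qed.

End Comparison.

(** * Bases of translates *)

Lemma sum_ord_delta (R : pzRingType) (g : nat -> R) n i : (i < n)%N ->
  \sum_(k < n) (k == i :> nat)%:R * g k = g i.
Proof.
move=> ilt; rewrite (bigD1 (Ordinal ilt))//= eqxx mul1r big1 ?addr0// => k ki.
rewrite (_ : (k == i :> nat) = false) ?mul0r//.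
by apply/eqP => e; move/eqP: ki; apply; exact: val_inj.
Qed.

Section TranslateBasis.
Context {R : realType}.
Variables (p : R) (f : R -> R) (lam : nat -> R) (X : set (R -> R)).
Local Notation mu := (@lebesgue_measure R).
Local Notation b := (fun i => translate f (lam i)).
Hypotheses (p1 : 1 <= p) (Lf : Lp_fun p f) (clX : closed_subspace p X)
  (basX : unconditional_basis p b X).

(** If two parameters are close, continuity of translation makes [b i - b j] small. Flipping the
    sign at [j] makes [b i + b j] small as well, up to the factor [C], and then so is [2 * b i],
    although its norm is twice that of [f]. *)
Lemma translates_separated : exists2 eta : R, 0 < eta &
  forall i j, i != j -> eta <= `|lam i - lam j|.
Proof.
have [C C0 HC] := unconditional_constant_Lp p1 clX basX.
have Lb i : in_Lp mu p (b i) by exact: (@in_Lp_translate R p f (lam i) p1 Lf).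
have Nb i : Lp_norm p (b i) = Lp_norm p f by exact: (norm_p_translate p (lam i) Lf.1).
have F0 : 0 < Lp_norm p f by rewrite -(Nb 0%N); exact: (basis_Lp_norm_gt0 p1 clX basX 0).
have C1 : 0 < 1 + C by rewrite addr_gt0.
(* A difference of norm at most [F / (1 + C)], with [F] the norm of [f], would give [2 * F <= F]. *)
have [delta delta0 hd] := Lp_translation_continuous p1 Lf (divr_gt0 F0 C1).
exists delta => // i j ij; rewrite leNgt; apply/negP => /ltW /hd.
have Lij : in_Lp mu p (fun t => translate f (lam i - lam j) t - f t).
  by apply: in_LpB => //; exact: in_Lp_translate.
rewrite -(norm_p_translate p (lam j) Lij.1).
rewrite (_ : translate _ _ = fun t => b i t - b j t); last first.
  by apply/funext => t; rewrite /translate; congr (f _ - _); ring.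
pose x t := b i t - b j t; rewrite -/x => small.
pose a k : R := (k == i)%:R - (k == j)%:R.
pose n := (maxn i j).+1.
have ilt : (i < n)%N by rewrite ltnS leq_maxl.
have jlt : (j < n)%N by rewrite ltnS leq_maxr.
have xE : psum a b id n = x.
  apply/funext => t; rewrite /psum /x /a.
  under eq_bigr do rewrite mulrBl.
  by rewrite sumrB (sum_ord_delta (fun k => b k t) ilt) (sum_ord_delta (fun k => b k t) jlt).
have Xx : X x by rewrite -xE; exact: (psum_in_subspace clX basX).
have ax : Lp_conv p (psum a b id) x.
  rewrite -xE; apply: (Lp_conv_finite p1 clX basX) => k nk.
  by rewrite /a (gtn_eqF (leq_trans ilt nk)) (gtn_eqF (leq_trans jlt nk)) subrr.
have := HC x a n (fun k => k == j) Xx ax.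
rewrite (_ : (fun t => _) = fun t => b i t + b j t); last first.
  apply/funext => t; rewrite (eq_bigr (fun k : 'I_n =>
    (k == i :> nat)%:R * b k t + (k == j :> nat)%:R * b k t)); last first.
    move=> k _; rewrite /a; have [->|_] := eqVneq (k : nat) j.
      by rewrite eq_sym (negbTE ij) /= expr1; ring.
    by rewrite /= expr0; ring.
  by rewrite big_split (sum_ord_delta (fun k => b k t) ilt) (sum_ord_delta (fun k => b k t) jlt).
move=> signed.
have Lx : in_Lp mu p x by exact: in_LpB.
have := norm_pD p1 Lx (in_LpD p1 (Lb i) (Lb j)).
rewrite (_ : (fun t => _) = fun t => 2 * b i t); last first.
  by apply/funext => t; rewrite /x; ring.
rewrite (norm_pZ p1 2 (Lb i)) ger0_norm// => tri.
have {}small : Lp_norm p x * (1 + C) <= Lp_norm p f by rewrite -ler_pdivlMr.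
have {}tri : 2 * Lp_norm p (b i) <= Lp_norm p x + Lp_norm p (fun t => b i t + b j t) by exact: tri.
by rewrite Nb in tri; move: small tri signed F0; lra.
Qed.

Hypotheses (p2 : 2 <= p) (p4 : p <= 4).

(** The signs are averaged out before discretizing: restricting [X] to a
    bounded set need not be compact, but the square function restricted to a
    cell depends on finitely many coefficients up to a small error. *)
Lemma embeds_into_lp_translates : embeds_into_lp p X.
Proof.
have p0 : 0 < p by rewrite (lt_le_trans _ p1).
have [eta eta0 sep] := translates_separated.
have [C C0 HC] := unconditional_constant_Lp p1 clX basX.
have Lb i : in_Lp mu p (b i) by exact: (@in_Lp_translate R p f (lam i) p1 Lf).
have mb i : measurable_fun setT (b i) by exact: (Lb i).1.
have Nb i : Lp_norm p (b i) = Lp_norm p f by exact: (norm_p_translate p (lam i) Lf.1).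
have F0 : 0 < Lp_norm p f by rewrite -(Nb 0%N); exact: (basis_Lp_norm_gt0 p1 clX basX 0).
pose N := Lp_norm p f `^ p.
have N0 : 0 < N by exact: powR_gt0.
have bN i : Lp_int mu p (b i) = N%:E.
  by rewrite (in_Lp_int p1 (Lb i)) /N -(Nb i).
have [kappa [mkappa kappa_small kappa_le]] := exists_cells eta0.
have sumF k : (\sum_(i <oo) \int[mu]_(t in kappa @^-1` [set k])
    (`|b i t| `^ p)%:E < +oo)%E.
  apply: le_lt_trans (@sum_translates_cell R p eta f lam _ Lf.1 (mkappa k) sep _) _.
    by move=> s t /= sk tk; apply: kappa_small; rewrite sk tk.
  have Lf' : in_Lp mu p f by exact: Lf.
  by rewrite (in_Lp_int p1 Lf') ltry.
have q0 : 0 < 2 `^ p by exact: powR_gt0.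
(* The value that turns the smallness condition into an equality. *)
pose rho := N / (8 * 2 `^ p).
have rho0 : 0 < rho by rewrite divr_gt0// mulr_gt0.
have rho_small : 2 `^ p * (4 * rho) <= N / 2.
  by rewrite /rho le_eqVlt; apply/orP; left; apply/eqP; field; rewrite gt_eqF.
have [phi [M [H [mphi fphi HM hrho]]]] :=
  discretize p1 mb eta0 mkappa kappa_le sumF rho0.
pose h i t := H i (phi t).
have mh i : measurable_fun [set: R] (h i) by exact: (measurable_fun_fibers (H i) mphi).
have [L [Llin Lsum]] := @lp_encoding _ _ R mu p p0 phi M H mphi fphi.
pose K := 2 * 2 `^ p.
have K0 : 0 < K by rewrite mulr_gt0.
(* Each direction uses the unconditional constant once and the comparison of the averages of [b] and
   [h], with factor [K] on [p]-th powers, once; so one constant serves for both. *)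
pose B := K `^ p^-1 * C.
have B0 : 0 < B by rewrite mulr_gt0// powR_gt0.
have BE s : 0 <= s -> (B * s) `^ p = K * (C * s) `^ p.
  move=> s0; rewrite /B -mulrA powRM ?powR_ge0 ?mulr_ge0 ?(ltW C0)//.
  by rewrite powRVK ?gt_eqF// ltW.
have bounds x a : X x -> Lp_conv p (psum a b id) x ->
    lp_seq p (L a) /\ lp_norm p (L a) <= B * Lp_norm p x /\
    Lp_norm p x <= B * lp_norm p (L a).
  move=> Xx ax.
  have Nx0 : 0 <= Lp_norm p x by exact: norm_p_ge0.
  have up n := sign_int_le_norm p1 clX basX HC n Xx ax.
  have fin n : sign_int mu p n b a \is a fin_num.
    by rewrite ge0_fin_numE ?sign_int_ge0//; apply: le_lt_trans (up n) _; exact: ltry.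
  have cmp n := @sign_int_perturb _ _ R mu p N rho b h p2 p4 mb mh bN hrho rho_small n a (fin n).
  have [Qge Qle] := @sign_int_lim _ _ _ mu p h a (fun t => M (phi t)) p2 mh
    (fun i t Mi => HM i (phi t) Mi).
  have LQ : Lp_int counting p (L a) = (\int[mu]_t (sign_avg (M (phi t))
      (fun s => `|s| `^ p) (fun i => a i * h i t)%R)%:E)%E.
    rewrite /Lp_int ge0_integral_count; last by move=> k; rewrite lee_fin powR_ge0.
    exact: Lsum.
  have Lle : (Lp_int counting p (L a) <= ((B * Lp_norm p x) `^ p)%:E)%E.
    rewrite LQ; apply: Qle => n; apply: le_trans (cmp n).2 _.
    rewrite BE// (EFinM K); apply: lee_wpmul2l; last exact: up.
    by rewrite lee_fin ltW.
  have La : in_Lp (@counting nat R) p (L a).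
    by apply: in_LpP => //; apply: le_lt_trans Lle _; exact: ltry.
  have l0 : 0 <= lp_norm p (L a) by exact: norm_p_ge0.
  split; first exact: La.2.
  split; first by apply: (norm_p_le p1 _ La Lle); rewrite mulr_ge0// ltW.
  have part n : Lp_norm p (psum a b id n) <= B * lp_norm p (L a).
    apply: (norm_p_le p1); [by rewrite mulr_ge0// ltW| |].
      by case: clX => + _ _ _; apply; exact: (psum_in_subspace clX basX).
    have Lpart : in_Lp mu p (psum a b id n).
      by case: clX => + _ _ _; apply; exact: (psum_in_subspace clX basX).
    rewrite (in_Lp_int p1 Lpart).
    apply: le_trans (psum_norm_le_sign_int p1 clX basX C0 HC a n) _.
    rewrite BE// [in leRHS]powRM ?(ltW C0)// mulrCA EFinM.
    apply: lee_wpmul2l; first by rewrite lee_fin powR_ge0.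
    apply: le_trans (cmp n).1 _; rewrite (EFinM K); apply: lee_wpmul2l.
      by rewrite lee_fin ltW.
    apply: le_trans (Qge n) _; rewrite -LQ (in_Lp_int p1 La).
    exact: lexx.
  (* The lower estimate is available for partial sums with a bound independent of [n]; [x] is within
     [e] of one of them. *)
  apply/ler_addgt0Pr => e e0.
  have /cvgrPdist_le/(_ e e0) [n _ /(_ n (leqnn n))] := ax.
  rewrite /= sub0r normrN ger0_norm; last exact: norm_p_ge0.
  move=> near_x.
  have Lpart : in_Lp mu p (psum a b id n).
    by case: clX => + _ _ _; apply; exact: (psum_in_subspace clX basX).
  have Lx : in_Lp mu p x by case: clX => + _ _ _; apply.
  have Ld := in_LpB p1 Lpart Lx.
  have := norm_pD p1 Lpart (in_LpZ p1 (-1) Ld).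
  rewrite (_ : (fun t => _) = x); last by apply/funext => t; ring.
  rewrite (norm_pZ p1 (-1) Ld) normrN1 mul1r => tri.
  exact: le_trans tri (lerD (part n) near_x).
(* The embedding must be a total function; off [X] the coefficients are arbitrary. *)
have coef (x : R -> R) : exists a, X x -> Lp_conv p (psum a b id) x.
  have [Xx|nXx] := pselect (X x); last by exists (fun=> 0).
  by have [_ /(_ x Xx) [[a [ax _]] _]] := basX; exists a.
have [cf hcf] := choice coef.
exists (fun x => L (cf x)); split.
- move=> c c' x y Xx Xy; apply/funext => k; rewrite -Llin; congr (L _ k).
  have Xxy : X (fun t => c * x t + c' * y t) by case: clX => _ _ + _; apply.
  have [_ /(_ _ Xxy) [[a [_ ua]] _]] := basX.
  rewrite -(ua _ (hcf _ Xxy)); apply: ua.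
  exact: (Lp_conv_lin p1 clX basX c c' Xx Xy (hcf _ Xx) (hcf _ Xy)).
- by move=> x Xx; have [] := bounds x (cf x) Xx (hcf _ Xx).
exists B^-1, B; split=> [||x Xx]; [by rewrite invr_gt0|by []|].
have [_ [up lo]] := bounds x (cf x) Xx (hcf _ Xx); split=> //.
by rewrite mulrC ler_pdivrMr// mulrC.
Qed.

End TranslateBasis.

Theorem theorem2p12 (R : realType) (p : R) (f : R -> R) (lam : nat -> R)
    (X : set (R -> R)) :
  2 < p -> p <= 4 ->
  Lp_fun p f ->
  closed_subspace p X ->
  unconditional_basis p (fun i => translate f (lam i)) X ->
  embeds_into_lp p X.
Proof.
move=> p2 p4 Lf clX basX.
have p1 : 1 <= p by apply: le_trans (ltW p2); rewrite ler1n.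
exact: (embeds_into_lp_translates p1 Lf clX basX (ltW p2) p4).
Qed.
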